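(* Let $m\ge 1$, let $\beta=(\beta_n)_{n\in\mathbb N^m}$ be a multi-sequence of positive numbers, and suppose the multiplication $m$-tuple $M_z=(M_{z_1},\dots,M_{z_m})$ on $H^2(\beta)$ is bounded. Then $M_z$ is spherical if and only if there is a sequence $b_0,b_1,b_2,\dots$ of positive numbers such that $$\|f\|_\beta^2=\sum_{k=0}^\infty b_k^2\,\|f_{[k]}\|^2_{L^2(\partial\mathbb B,\sigma)}\qquad (f\in H^2(\beta)).$$ If this happens, then $M_z$ is unitarily equivalent to the $m$-variable weighted shift with weights $$w^{(i)}_n=\frac{b_{|n|+1}}{b_{|n|}}\sqrt{\frac{n_i+1}{|n|+m}}\qquad(n\in\mathbb N^m,\ 1\le i\le m),$$ and $\beta_n=\|z^n\|_\beta$ is given by $$\beta_n=b_{|n|}\sqrt{\frac{(m-1)!\,n!}{(m-1+|n|)!}}\qquad(n\in\mathbb N^m).$$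
   Context: $\mathbb N=\{0,1,2,\dots\}$. For $n=(n_1,\dots,n_m)\in\mathbb N^m$: $|n|=n_1+\dots+n_m$, $n!=n_1!\cdots n_m!$, $z^n=z_1^{n_1}\cdots z_m^{n_m}$, and $\epsilon_j$ is the multi-index with $1$ in the $j$-th place and $0$ elsewhere. For a multi-sequence $\beta$ of positive numbers, $H^2(\beta)$ is the Hilbert space of formal power series $f(z)=\sum_{n\in\mathbb N^m}a_nz^n$ with $\|f\|_\beta^2=\sum_n|a_n|^2\beta_n^2<\infty$; $M_{z_j}$ is multiplication by $z_j$. For such $f$, $f_{[k]}=\sum_{|n|=k}a_nz^n$ is its homogeneous part of degree $k$. $\sigma$ is the normalized surface area measure on the unit sphere $\partial\mathbb B=\{z\in\mathbb C^m:|z_1|^2+\dots+|z_m|^2=1\}$. For $U=(u_{jk})$ in the unitary group $\mathcal U(m)$ and a commuting operator $m$-tuple $T=(T_1,\dots,T_m)$, $T_U$ is the $m$-tuple with $(T_U)_j=\sum_k u_{jk}T_k$. A commuting $m$-tuple $T$ of bounded operators on an infinite-dimensional Hilbert space $\mathcal H$ is spherical if for every $U\in\mathcal U(m)$ there is a unitary $\Gamma(U)$ on $\mathcal H$ with $\Gamma(U)T_j=(T_U)_j\Gamma(U)$ for all $j$. An $m$-variable weighted shift with positive weights $\{w^{(j)}_n\}$ with respect to an orthonormal basis $\{e_n\}_{n\in\mathbb N^m}$ is the commuting tuple defined by $T_je_n=w^{(j)}_ne_{n+\epsilon_j}$. *)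

(* Defs.v *)
From HB Require Import structures.
From mathcomp Require Import all_boot all_order all_algebra.
From mathcomp Require Import all_classical all_reals all_analysis.
From mathcomp Require Import complex.

Set Implicit Arguments.
Unset Strict Implicit.
Unset Printing Implicit Defensive.

Import Order.TTheory GRing.Theory Num.Theory.
Local Open Scope ring_scope.
Local Open Scope classical_set_scope.

Section Defs.
Variables (R : realType) (m : nat).

Definition mi := {ffun 'I_m -> nat}.

Definition mdeg (n : mi) : nat := (\sum_(i < m) n i)%N.

Definition mfact (n : mi) : nat := (\prod_(i < m) (n i)`!)%N.

(* n - epsilon_j  (only used when n_j > 0) *)
Definition mpred (j : 'I_m) (n : mi) : mi := [ffun i => (n i - (i == j))%N].

Definition cabs2 (a : R[i]) : R := complex.Re a ^+ 2 + complex.Im a ^+ 2.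

Definition cconj (a : R[i]) : R[i] := Complex (complex.Re a) (- complex.Im a).

(* formal power series are represented by their coefficient families *)
Definition series := mi -> R[i].

Definition H2norm2 (beta : mi -> R) (a : series) : \bar R :=
  \esum_(n in [set: mi]) (cabs2 (a n) * beta n ^+ 2)%:E.

Definition inH2 (beta : mi -> R) (a : series) : Prop := (H2norm2 beta a < +oo)%E.

Definition Mz (j : 'I_m) (a : series) : series :=
  fun n => if (0 < n j)%N then a (mpred j n) else 0.

Definition bounded_op (beta : mi -> R) (T : series -> series) : Prop :=
  exists C : R, forall a, inH2 beta a ->
    inH2 beta (T a) /\ (H2norm2 beta (T a) <= C%:E * H2norm2 beta a)%E.

Definition unitary_between (beta beta' : mi -> R) (G : series -> series) : Prop :=
  [/\ forall a, inH2 beta a -> inH2 beta' (G a),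
      forall (c : R[i]) a b, inH2 beta a -> inH2 beta b ->
        G (fun n => c * a n + b n) = (fun n => c * G a n + G b n),
      forall a, inH2 beta a -> H2norm2 beta' (G a) = H2norm2 beta a
    & forall b, inH2 beta' b -> exists2 a, inH2 beta a & G a = b].

Definition unitary_mx (U : 'M[R[i]]_m) : Prop :=
  U *m (map_mx cconj U)^T = 1%:M.

Definition spherical (beta : mi -> R) : Prop :=
  forall U : 'M[R[i]]_m, unitary_mx U ->
    exists G, unitary_between beta beta G /\
      forall (j : 'I_m) a, inH2 beta a ->
        G (Mz j a) = (fun n => \sum_(k < m) U j k * Mz k (G a) n).

Definition hom_eval (a : series) (k : nat) (z : 'I_m -> R[i]) : R[i] :=
  \sum_(n : {ffun 'I_m -> 'I_k.+1} | (\sum_(i < m) (n i : nat) == k)%N)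
     a [ffun i => (n i : nat)] * \prod_(i < m) z i ^+ (n i).

(* Lebesgue integral over R^d of a non-negative function of the first d
   coordinates, as an iterated integral (Tonelli). *)
Fixpoint iint (d : nat) (g : (nat -> R) -> \bar R) : \bar R :=
  match d with
  | 0 => g (fun _ => 0)
  | d'.+1 => (\int[@lebesgue_measure R]_t
                 iint d' (fun x => g (fun i => if i == d' then t else x i)))%E
  end.

Definition rsq (x : nat -> R) : R := \sum_(i < 2 * m) x i ^+ 2.

Definition toC (x : nat -> R) : 'I_m -> R[i] :=
  fun j => Complex (x (2 * j)%N) (x (2 * j).+1).

Definition ball_vol : \bar R :=
  iint (2 * m) (fun x => if rsq x <= 1 then 1%E else 0%E).

(* integral over the unit sphere w.r.t. sigma, for non-negative h, defined
   through the cone measure: sigma(E) = vol({r x : 0 < r <= 1, x in E}) / vol(B),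
   which is the normalized surface area measure. *)
Definition sphere_int (h : ('I_m -> R[i]) -> \bar R) : \bar R :=
  (iint (2 * m) (fun x => if ((0 < rsq x) && (rsq x <= 1))%R
                          then h (toC (fun i => (x i / Num.sqrt (rsq x))%R))
                          else 0%E)
   * ((fine ball_vol)^-1)%:E)%E.

Definition L2sq (a : series) (k : nat) : \bar R :=
  sphere_int (fun z => (cabs2 (hom_eval a k z))%:E).

Definition norm_identity (beta : mi -> R) (b : nat -> R) : Prop :=
  forall a, inH2 beta a ->
    H2norm2 beta a = \esum_(k in [set: nat]) ((b k ^+ 2)%:E * L2sq a k)%E.

(* m-variable weighted shift with weights w on l^2(N^m) = H^2(1), with respect
   to its standard orthonormal basis e_n: T_j e_n = w_j(n) e_(n + eps_j) *)
Definition wshift (w : 'I_m -> mi -> R) (j : 'I_m) (c : series) : series :=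
  fun n => if (0 < n j)%N then Complex (w j (mpred j n)) 0 * c (mpred j n) else 0.

Definition one_weight : mi -> R := fun _ => 1.

Definition unit_equiv_wshift (beta : mi -> R) (w : 'I_m -> mi -> R) : Prop :=
  exists V, unitary_between beta one_weight V /\
    forall (j : 'I_m) a, inH2 beta a -> V (Mz j a) = wshift w j (V a).

Definition thm_weights (b : nat -> R) : 'I_m -> mi -> R :=
  fun i n => b (mdeg n).+1 / b (mdeg n) *
             Num.sqrt ((n i).+1%:R / (mdeg n + m)%:R).

End Defs.

(* Main.v *)
(** If [M_z] is spherical then the constant [1] is an eigenvector of every
    intertwining unitary [Gamma(U)], so [Gamma(U)] sends [z^p z_i^r] to a
    unimodular multiple of [z^p (c z_i + s z_j)^r] when [U] is a rotation in the
    plane of [z_i] and [z_j].  Comparing norms gives a polynomial identity in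
    [(c/s)^2] that forces [beta_n^2 / n!] to depend on [|n|] only.  The squared
    norms of the monomials in [L^2(sigma)] satisfy the same relation, because
    [sigma] is rotation invariant (the iterated Lebesgue integral is invariant
    under shears, hence under plane rotations) and the monomials are orthogonal
    (a phase rotation flips the sign of part of a sum); together with
    [|z_1|^2 + ... + |z_m|^2 = 1] this determines them.  Conversely, if [beta_n^2 / n!] depends on [|n|] only, then the
    substitution [f(z) |-> f(Uz)] preserves [sum_{|n|=k} n! |a_n|^2] for each
    [k], hence is unitary. *)

Require Import Defs.
From HB Require Import structures.
From mathcomp Require Import all_boot all_order all_algebra.
From mathcomp Require Import all_classical all_reals all_analysis.
From mathcomp Require Import measurable_realfun complex ring lra zify.

Import Order.TTheory GRing.Theory Num.Theory.
Local Open Scope ring_scope.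

Set Implicit Arguments.
Unset Strict Implicit.
Unset Printing Implicit Defensive.

(** Everything passes through [plane_relation], which holds both for [beta n ^+ 2] and for the
    squared monomial norms on the sphere. It is solved once, by [plane_relationP]: both families
    have the form [C (mdeg n) * n!], so their quotient depends on the degree only, and its square
    root is the sequence [b]. Two features of the definitions shape the proof. Unitaries are given
    by linearity, norm preservation and surjectivity, and [sphere_int] is meant for non-negative
    integrands; so no inner product is at hand. Orthogonality of monomials is therefore expressed by
    additivity of squared norms, and the eigenvector property of [1] comes from norm bounds for [1]
    and for its preimage. Secondly, the sphere is reached through an iterated integral in Cartesian
    coordinates, where the symmetries directly available are translations in one coordinate and
    Tonelli. For the converse, the coefficients of [f(Uz)] are built from derivatives rather than
    from multinomial expansions. The weight [n!] is the one for which a squared norm in degree [k+1]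
    is, up to the factor [k+1], that of the gradient in degree [k], and a unitary matrix acts on the
    gradient isometrically. *)

(** * Iterated Lebesgue integrals and their invariance under plane rotations *)

Section IteratedIntegral.
Local Open Scope ereal_scope.
Variable R : realType.
Implicit Types (g h : (nat -> R) -> \bar R) (x : nat -> R).

Definition upd (p : nat) (t : R) x : nat -> R :=
  fun i => if i == p then t else x i.

Lemma updC p q s t x : p != q -> upd p s (upd q t x) = upd q t (upd p s x).
Proof.
move=> pq; apply/funext => i; rewrite /upd.
by case: (eqVneq i p) => [->|//]; rewrite (negbTE pq).
Qed.

Lemma upd_eq p t x : upd p t x p = t.
Proof. by rewrite /upd eqxx. Qed.

Lemma upd_neq p q t x : q != p -> upd p t x q = x q.
Proof. by rewrite /upd => /negbTE ->. Qed.

Lemma upd_same p s t x : upd p s (upd p t x) = upd p s x.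
Proof. by apply/funext => i; rewrite /upd; case: (i == p). Qed.

(** Integrating out one coordinate gives again a function on [nat -> R], so integrations can be
    permuted without changing types. *)
Definition Ip (p : nat) g : (nat -> R) -> \bar R :=
  fun x => \int[@lebesgue_measure R]_t g (upd p t x).

Fixpoint Iall (d : nat) g : (nat -> R) -> \bar R :=
  if d is d'.+1 then Ip d' (Iall d' g) else g.

(* Composing with an arbitrary coordinatewise measurable family avoids fixing a
   sigma-algebra on [nat -> R]. *)
Definition admissible g :=
  (forall x, 0 <= g x) /\
  forall d (T : measurableType d) (F : T -> nat -> R),
    (forall i, measurable_fun setT ((fun w => F w i) : T -> R)) ->
    measurable_fun setT ((fun w => g (F w)) : T -> \bar R).

Lemma measurable_upd p x i : measurable_fun setT (fun t => upd p t x i).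
Proof.
rewrite /upd; case: (i == p); first exact: measurable_id.
exact: measurable_cst.
Qed.

Lemma admissible_upd g p x :
  admissible g -> measurable_fun setT ((fun t => g (upd p t x)) : R -> \bar R).
Proof. by case=> _ /(_ _ (measurableTypeR R) _ (measurable_upd p x)). Qed.

Lemma admissible_upd2 g p q x : admissible g ->
  measurable_fun setT
    ((fun w => g (upd p w.1 (upd q w.2 x))) :
       measurableTypeR R * measurableTypeR R -> \bar R).
Proof.
case=> _; apply => i; rewrite /upd; case: (i == p); first exact: measurable_fst.
case: (i == q); first exact: measurable_snd.
exact: measurable_cst.
Qed.

Lemma Ip_admissible p g : admissible g -> admissible (Ip p g).
Proof.
move=> ag; split=> [x|d T F mF].
  by apply: integral_ge0 => t _; case: ag.
have mf : measurable_fun setT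
    ((fun w => g (upd p w.2 (F w.1))) : T * measurableTypeR R -> \bar R).
  apply: (ag.2) => i; rewrite /upd; case: (i == p); first exact: measurable_snd.
  by apply: measurableT_comp (mF i) _; exact: measurable_fst.
apply: (@measurable_fun_fubini_tonelli_F _ _ _ _ _ (@lebesgue_measure R)
   (fun w : T * measurableTypeR R => g (upd p w.2 (F w.1))) mf) => w.
exact: ag.1.
Qed.

Lemma Iall_admissible d g : admissible g -> admissible (Iall d g).
Proof. by move=> ag; elim: d => [//|d IH]; exact: Ip_admissible. Qed.

Lemma IpC p q g x : p != q -> admissible g -> Ip p (Ip q g) x = Ip q (Ip p g) x.
Proof.
move=> pq ag; rewrite /Ip.
have -> : \int[lebesgue_measure]_t \int[lebesgue_measure]_s
    g (upd q s (upd p t x)) =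
    \int[lebesgue_measure]_t \int[lebesgue_measure]_s g (upd p t (upd q s x)).
  by apply: eq_integral => t _; apply: eq_integral => s _; rewrite updC // eq_sym.
apply: (@fubini_tonelli _ _ _ _ _ (@lebesgue_measure R) (@lebesgue_measure R)
  (fun w : measurableTypeR R * measurableTypeR R =>
       g (upd p w.1 (upd q w.2 x)))); first exact: admissible_upd2.
by move=> w; exact: ag.1.
Qed.

Lemma Iall_upd d p g t x : (d <= p)%N ->
  Iall d (fun y => g (upd p t y)) x = Iall d g (upd p t x).
Proof.
elim: d x => [//|d IH] x dp /=; rewrite /Ip; apply: eq_integral => s _.
by rewrite IH 1?ltnW // updC // neq_ltn dp orbT.
Qed.

(** [iint] overwrites coordinates inside the integrand, [Iall] in the base point; [Iall d] leaves
    the coordinates from [d] on alone, so the overwriting can be moved across it. *)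
Lemma iintE d g : iint d g = Iall d g (fun=> 0%R).
Proof.
elim: d g => [//|d IH] g /=; apply: eq_integral => t _.
by rewrite IH (@Iall_upd d d g t).
Qed.

Lemma Ip_Iall d p g x : (d <= p)%N -> admissible g ->
  Ip p (Iall d g) x = Iall d (Ip p g) x.
Proof.
elim: d x => [//|d IH] x dp ag /=.
rewrite IpC ?neq_ltn ?dp ?orbT //; last exact: Iall_admissible.
by rewrite /Ip; apply: eq_integral => t _; apply: IH => //; exact: ltnW.
Qed.

(** By Tonelli the integration over coordinate [p] may be carried out innermost. *)
Lemma eq_Iall d p g h x : (p < d)%N -> admissible g -> admissible h ->
  (forall y, Ip p g y = Ip p h y) -> Iall d g x = Iall d h x.
Proof.
move=> + ag ah gh; elim: d x => [//|d IH] x.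
rewrite ltnS leq_eqVlt => /orP[/eqP <-|pd] /=.
  by rewrite !Ip_Iall //; congr (Iall _ _ _); apply/funext.
by rewrite /Ip; apply: eq_integral => t _; exact: IH.
Qed.

Lemma eq_iint_Ip d p g h : (p < d)%N -> admissible g -> admissible h ->
  (forall y, Ip p g y = Ip p h y) -> iint d g = iint d h.
Proof. by move=> pd ag ah gh; rewrite !iintE; exact: eq_Iall gh. Qed.

(** The push-forward under a translation gives half-open intervals their length, and Lebesgue
    measure is the only measure that does. *)
Lemma lebesgue_measure_translation (a : R) (A : set R) : measurable A ->
  lebesgue_measure ((fun t : R => (t + a)%R) @^-1` A) = lebesgue_measure A.
Proof.
move=> mA.
have mf : measurable_fun setT
  ((fun t : R => (t + a)%R) : measurableTypeR R -> measurableTypeR R).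
  by apply: measurable_funD => //; exact: measurable_id.
rewrite [RHS](@lebesgue_measure_unique _
  (pushforward lebesgue_measure ((fun t : R => (t + a)%R) :
     measurableTypeR R -> measurableTypeR R))) // => X [[u v] _ <-].
rewrite [RHS](_ : _ = lebesgue_measure `](u - a)%R, (v - a)%R]%classic);
  last first.
  rewrite /pushforward; congr (lebesgue_measure _).
  by apply/seteqP; split => t /=; rewrite !in_itv /= ltrBlDr lerBrDr.
by rewrite !lebesgue_measure_itv /= !lte_fin ltrD2r -!EFinB; case: ifP => // _;
  congr _%:E; ring.
Qed.

Lemma ge0_integral_translation (f : R -> \bar R) (a : R) :
  measurable_fun setT f -> (forall t, 0 <= f t) ->
  \int[@lebesgue_measure R]_t f (t + a)%R = \int[@lebesgue_measure R]_t f t.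
Proof.
move=> mf f0.
have mT : measurable_fun setT
  ((fun t : R => (t + a)%R) : measurableTypeR R -> measurableTypeR R).
  by apply: measurable_funD => //; exact: measurable_id.
transitivity (\int[pushforward lebesgue_measure ((fun t : R => (t + a)%R) :
    measurableTypeR R -> measurableTypeR R)]_t f t).
  by rewrite ge0_integral_pushforward.
by apply: eq_measure_integral => A mA _; exact: lebesgue_measure_translation.
Qed.

Definition shear (p q : nat) (a : R) x := upd p (x p + a * x q)%R x.

Lemma measurable_shear p q a d (T : measurableType d) (F : T -> nat -> R) i :
  (forall i, measurable_fun setT ((fun w => F w i) : T -> R)) ->
  measurable_fun setT (fun w => shear p q a (F w) i).
Proof.
move=> mF; rewrite /shear /upd; case: (i == p) => //.
by apply: measurable_funD => //; apply: measurable_funM => //; exact: measurable_cst.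
Qed.

Lemma admissible_shear p q a g : admissible g -> admissible (g \o shear p q a).
Proof.
case=> g0 mg; split=> [x|d T F mF]; first exact: g0.
by apply: (mg _ _ (fun w => shear p q a (F w))) => i; exact: measurable_shear.
Qed.

(** Once the other coordinates are fixed, a shear is a translation of coordinate [p] by a
    constant. *)
Lemma iint_shear d p q a g : (p < d)%N -> p != q -> admissible g ->
  iint d (g \o shear p q a) = iint d g.
Proof.
move=> pd pq ag; apply: (eq_iint_Ip pd) => //; first exact: admissible_shear.
move=> y; rewrite /Ip -[RHS](ge0_integral_translation (a * y q)%R).
- apply: eq_integral => t _ /=; rewrite /shear upd_same.
  by rewrite upd_eq upd_neq // eq_sym.
- exact: admissible_upd.
- by move=> t; exact: ag.1.
Qed.

Definition plane_rot (p q : nat) (c s : R) x :=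
  upd p (c * x p - s * x q)%R (upd q (s * x p + c * x q)%R x).

(** The classical factorization of a rotation into three shears. The coefficient [s / (1 + c)] is
    the tangent of half the angle, which excludes the half turn [c = -1]. *)
Lemma plane_rot_shear p q c s x : p != q -> (c ^+ 2 + s ^+ 2 = 1)%R ->
  (c != -1)%R ->
  plane_rot p q c s x =
  shear p q (- (s / (1 + c)))%R (shear q p s (shear p q (- (s / (1 + c)))%R x)).
Proof.
move=> pq cs c1; have c0 : (1 + c != 0)%R by rewrite addrC addr_eq0.
have qp : (q == p) = false by rewrite eq_sym (negbTE pq).
have e1 : (s * (s / (1 + c)) = 1 - c)%R.
  rewrite mulrA -expr2 (_ : s ^+ 2 = (1 - c) * (1 + c))%R ?mulfK //.
  by move: cs; lra.
set k := (s / (1 + c))%R in e1 *.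
have e2 : (k * c = s - k)%R.
  by rewrite /k; field.
apply/funext => i; rewrite /plane_rot /shear /upd !eqxx (negbTE pq) qp.
case: (eqVneq i p) => [_|ip].
  rewrite [RHS](_ : _ = x p * (1 - s * k) + x q * (- k - k * (1 - s * k)))%R; last by ring.
  by rewrite e1 (_ : - k - k * (1 - (1 - c)) = - s)%R; [ring | lra].
case: (eqVneq i q) => [_|iq//].
rewrite [RHS](_ : _ = s * x p + (1 - s * k) * x q)%R; last by ring.
by rewrite e1; ring.
Qed.

Lemma admissible_plane_rot p q c s g :
  admissible g -> admissible (g \o plane_rot p q c s).
Proof.
case=> g0 mg; split=> [x|d T F mF]; first exact: g0.
apply: (mg _ _ (fun w => plane_rot p q c s (F w))) => i.
rewrite /plane_rot /upd; case: (i == p); last case: (i == q) => //.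
- by apply: measurable_funB; apply: measurable_funM => //; exact: measurable_cst.
- by apply: measurable_funD; apply: measurable_funM => //; exact: measurable_cst.
Qed.

Lemma iint_plane_rot d p q c s g : (p < d)%N -> (q < d)%N -> p != q ->
  (c ^+ 2 + s ^+ 2 = 1)%R -> admissible g ->
  iint d (g \o plane_rot p q c s) = iint d g.
Proof.
move=> pd qd pq; have main : forall c' s' g', (c' ^+ 2 + s' ^+ 2 = 1)%R ->
    c' != (-1)%R -> admissible g' -> iint d (g' \o plane_rot p q c' s') = iint d g'.
  move=> {}c {}s {}g cs c1 ag; set k := (- (s / (1 + c)))%R.
  have -> : g \o plane_rot p q c s =
      ((g \o shear p q k) \o shear q p s) \o shear p q k.
    by apply/funext => x /=; rewrite plane_rot_shear.
  by rewrite !iint_shear // 1?eq_sym //; do ?apply: admissible_shear.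
case: (eqVneq c (-1)%R) => [->|c1 cs ag]; last exact: main.
rewrite sqrrN expr1n => /(canRL (addKr _)); rewrite addNr.
move=> /eqP; rewrite sqrf_eq0 => /eqP -> ag.
(* The half turn is the square of the quarter turn. *)
have -> : g \o plane_rot p q (-1)%R 0%R =
    (g \o plane_rot p q 0%R 1%R) \o plane_rot p q 0%R 1%R.
  have qp : (q == p) = false by rewrite eq_sym (negbTE pq).
  apply/funext => x /=; congr g; apply/funext => i.
  rewrite /plane_rot /upd !eqxx qp; case: (i == p); last case: (i == q) => //; ring.
have e : (0 ^+ 2 + 1 ^+ 2 = 1 :> R)%R by rewrite expr0n expr1n add0r.
have n0 : (0 != -1 :> R)%R by rewrite eq_sym oppr_eq0 oner_eq0.
by rewrite !main //; exact: admissible_plane_rot.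
Qed.

Lemma iintD d g h : admissible g -> admissible h ->
  iint d (fun x => g x + h x) = iint d g + iint d h.
Proof.
move=> ag ah; rewrite !iintE; move: (fun=> 0%R) => x.
elim: d x => [//|d IH] x /=; rewrite /Ip.
rewrite -ge0_integralD //; do ?by [move=> t _; apply: (Iall_admissible d _).1
  | apply: admissible_upd; exact: Iall_admissible].
by apply: eq_integral => t _; exact: IH.
Qed.

Lemma iintZ d g (k : R) : (0 <= k)%R -> admissible g ->
  iint d (fun x => k%:E * g x) = k%:E * iint d g.
Proof.
move=> k0 ag; rewrite !iintE; move: (fun=> 0%R) => x.
elim: d x => [//|d IH] x /=; rewrite /Ip.
rewrite -ge0_integralZl_EFin //; do ?by [move=> t _; apply: (Iall_admissible d _).1
  | apply: admissible_upd; exact: Iall_admissible].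
by apply: eq_integral => t _; exact: IH.
Qed.

Lemma le_iint d g h : admissible g -> admissible h -> (forall x, g x <= h x) ->
  iint d g <= iint d h.
Proof.
move=> ag ah gh; rewrite !iintE; move: (fun=> 0%R) => x.
elim: d x => [//|d IH] x /=; rewrite /Ip.
apply: ge0_le_integral => //; do ?by [move=> t _; apply: (Iall_admissible d _).1
  | apply: admissible_upd; exact: Iall_admissible].
Qed.

Lemma iint_ge0 d g : admissible g -> 0 <= iint d g.
Proof. by move=> ag; rewrite iintE; apply: (Iall_admissible d ag).1. Qed.

(** Cubes are compared with the unit ball to bound its volume on both sides; the degenerate case
    [a = b] shows that the origin is negligible. *)
Lemma iint_box d (a b r : R) : (a <= b)%R -> (0 <= r)%R ->
  iint d (fun x => if [forall i : 'I_d, (a <= x i <= b)%R] then r%:E else 0) =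
  (r * (b - a) ^+ d)%:E.
Proof.
move=> ab r0.
(* After integrating the coordinates below [e], the constraints on the remaining ones survive as an
   indicator. *)
have H : forall e (y : nat -> R), (e <= d)%N ->
  Iall e (fun x => if [forall i : 'I_d, (a <= x i <= b)%R] then r%:E else 0) y =
  if [forall i : 'I_d, (e <= i)%N ==> (a <= y i <= b)%R]
  then (r * (b - a) ^+ e)%:E else 0.
  elim=> [|e IH] y ed /=.
    by rewrite mulr1; congr (if _ then _ else _); apply: eq_forallb => i.
  rewrite /Ip.
  under eq_integral => t _ do rewrite IH 1?ltnW //.
  set Q := [forall i : 'I_d, _]; set c := (r * (b - a) ^+ e)%R.
  have E t : [forall i : 'I_d, (e <= i)%N ==> (a <= upd e t y i <= b)%R] =
      (a <= t <= b)%R && Q.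
    apply/forallP/andP => [A|[at_ /forallP A] i].
      split; first by have := A (Ordinal ed); rewrite /= leqnn /upd eqxx.
      apply/forallP => i; apply/implyP => ei; have := A i.
      by rewrite (ltnW ei) /= /upd (gtn_eqF ei).
    apply/implyP; rewrite leq_eqVlt => /orP[/eqP <-|ei]; first by rewrite /upd eqxx.
    by have := A i; rewrite ei /= /upd (gtn_eqF ei).
  under eq_integral => t _ do rewrite E.
  clear E; case: Q => /=; last by under eq_integral => t _ do rewrite andbF; rewrite integral0.
  have c0 : (0 <= c)%R by rewrite mulr_ge0 ?exprn_ge0 // subr_ge0.
  transitivity (\int[@lebesgue_measure R]_(t in `[a, b]%classic) c%:E).
    rewrite [RHS]integral_mkcond; apply: eq_integral => t _.
    rewrite andbT patchE; congr (if _ then _ else _).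
    by apply/idP/idP; rewrite inE /= in_itv.
  rewrite integral_cst //= lebesgue_measure_itv /= lte_fin.
  rewrite /c exprSr mulrA; case: ifP => [_|/negbT]; first by rewrite -EFinB -EFinM.
  by rewrite -leNgt => ba; rewrite mule0 (_ : b - a = 0)%R ?mulr0 //; apply/eqP;
    rewrite subr_eq0 eq_le ab ba.
rewrite iintE H //; case: ifP => // /negP; case.
by apply/forallP => i; rewrite leqNgt ltn_ord.
Qed.

End IteratedIntegral.

(** * The normalized integral over the sphere for polynomial integrands *)

Section SphereIntegral.
Local Open Scope ereal_scope.
Variables (R : realType) (m : nat).
Hypothesis m_gt0 : (0 < m)%N.
Implicit Types (x : nat -> R) (z : 'I_m -> R[i]) (u v : ('I_m -> R[i]) -> R).

(** The real polynomials in the real and imaginary parts of the coordinates. Measurability,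
    boundedness on the sphere and stability under polynomial substitution all follow by
    induction. *)
Inductive regular : (('I_m -> R[i]) -> R) -> Prop :=
| regular_cst r : regular (fun=> r)
| regular_re j : regular (fun z => complex.Re (z j))
| regular_im j : regular (fun z => complex.Im (z j))
| regularD u v : regular u -> regular v -> regular (fun z => u z + v z)%R
| regularM u v : regular u -> regular v -> regular (fun z => u z * v z)%R.

Definition nnreg u := regular u /\ forall z, (0 <= u z)%R.

Lemma regular_measurable u : regular u ->
  forall d (T : measurableType d) (F : T -> nat -> R),
    (forall i, measurable_fun setT ((fun w => F w i) : T -> R)) ->
    measurable_fun setT ((fun w => u (toC (F w))) : T -> R).
Proof.
move=> ru d T F mF; elim: ru => [r|j|j|v w _ IHv _ IHw|v w _ IHv _ IHw] /=.
- exact: measurable_cst.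
- exact: mF.
- exact: mF.
- exact: measurable_funD.
- exact: measurable_funM.
Qed.

Lemma sum_cabs2_toC x : (\sum_(j < m) cabs2 (toC x j) = rsq m x)%R.
Proof.
rewrite /rsq /cabs2 /= -(big_mkord xpredT (fun i => x i ^+ 2)%R)
  -(big_mkord xpredT (fun j => x (2 * j)%N ^+ 2 + x (2 * j).+1 ^+ 2)%R).
elim: m => [|k IH]; first by rewrite muln0 !big_geq.
by rewrite mulnS add2n !big_nat_recr //= IH addrA.
Qed.

Lemma rsq_ge0 x : (0 <= rsq m x)%R.
Proof. by apply: sumr_ge0 => i _; exact: sqr_ge0. Qed.

Lemma cabs2_ge0 (a : R[i]) : (0 <= cabs2 a)%R.
Proof. by rewrite addr_ge0 ?sqr_ge0. Qed.

Lemma regular_bounded u : regular u -> exists2 C : R, (0 <= C)%R &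
  forall z, (\sum_(j < m) cabs2 (z j) = 1)%R -> (`|u z| <= C)%R.
Proof.
have coord z j : (\sum_(j < m) cabs2 (z j) = 1)%R -> (cabs2 (z j) <= 1)%R.
  move=> <-; rewrite (bigD1 j) //= lerDl; apply: sumr_ge0 => i _.
  exact: cabs2_ge0.
elim=> [r|j|j|v w _ [C C0 HC] _ [D D0 HD]|v w _ [C C0 HC] _ [D D0 HD]].
- by exists `|r|%R.
- exists 1%R => // z /(coord _ j) zj.
  by rewrite -ler_sqr ?nnegrE ?normr_ge0 // expr1n real_normK ?num_real // (le_trans _ zj) // lerDl sqr_ge0.
- exists 1%R => // z /(coord _ j) zj.
  by rewrite -ler_sqr ?nnegrE ?normr_ge0 // expr1n real_normK ?num_real // (le_trans _ zj) // lerDr sqr_ge0.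
- exists (C + D)%R => [|z z1]; first exact: addr_ge0.
  by rewrite (le_trans (ler_normD _ _)) // lerD ?HC ?HD.
- exists (C * D)%R => [|z z1]; first exact: mulr_ge0.
  by rewrite normrM ler_pM ?normr_ge0 ?HC ?HD.
Qed.

Definition normalize x : nat -> R := fun i => (x i / Num.sqrt (rsq m x))%R.

Lemma measurable_rsq d (T : measurableType d) (F : T -> nat -> R) :
  (forall i, measurable_fun setT ((fun w => F w i) : T -> R)) ->
  measurable_fun setT ((fun w => rsq m (F w)) : T -> R).
Proof.
by move=> mF; apply: measurable_sum => i; exact: measurable_funX.
Qed.

Lemma measurable_normalize d (T : measurableType d) (F : T -> nat -> R) i :
  (forall i, measurable_fun setT ((fun w => F w i) : T -> R)) ->
  measurable_fun setT ((fun w => normalize (F w) i) : T -> R).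
Proof.
(* As a real power the factor is measurable everywhere, including where [rsq] vanishes and the
   inverse is [0] by convention. *)
move=> mF; rewrite (_ : (fun _ => _) =
    (fun w => F w i * (rsq m (F w) `^ (- 2^-1)))%R); last first.
  by apply/funext => w; rewrite /normalize powRN powR12_sqrt // rsq_ge0.
apply: measurable_funM => //.
exact: (measurableT_comp (@measurable_powR R (- 2^-1)%R) (measurable_rsq mF)).
Qed.

(** The integrand of [sphere_int]: [u] extended to the punctured ball so as to be constant along
    rays. *)
Definition cone u x : \bar R :=
  if ((0 < rsq m x) && (rsq m x <= 1))%R then (u (toC (normalize x)))%:E else 0.

Lemma cone_admissible u : nnreg u -> admissible (cone u).
Proof.
move=> [ru u0]; split=> [x|d T F mF].
  by rewrite /cone; case: ifP => // _; rewrite lee_fin.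
apply: measurable_fun_ifT.
- apply: measurable_and.
  + by apply: measurable_fun_ltr; [exact: measurable_cst|exact: measurable_rsq].
  + by apply: measurable_fun_ler; [exact: measurable_rsq|exact: measurable_cst].
- apply/measurable_EFinP; apply: (@regular_measurable u ru).
  by move=> i; exact: measurable_normalize.
- exact: measurable_cst.
Qed.

Lemma rsq_normalize x : (0 < rsq m x)%R -> (rsq m (normalize x) = 1)%R.
Proof.
move=> x0; rewrite {1}/rsq /normalize.
under eq_bigr => i _ do rewrite exprMn exprVn sqr_sqrtr ?ltW //.
by rewrite -mulr_suml -/(rsq m x) mulfV ?gt_eqF.
Qed.

Lemma normalize_sphere x : (0 < rsq m x)%R ->
  (\sum_(j < m) cabs2 (toC (normalize x) j) = 1)%R.
Proof. by move=> x0; rewrite sum_cabs2_toC rsq_normalize. Qed.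

Lemma admissible_if (P : (nat -> R) -> bool) (r : R) : (0 <= r)%R ->
  (forall d (T : measurableType d) (F : T -> nat -> R),
    (forall i, measurable_fun setT ((fun w => F w i) : T -> R)) ->
    measurable_fun setT ((fun w => P (F w)) : T -> bool)) ->
  admissible (fun x => if P x then r%:E else 0).
Proof.
move=> r0 mP; split=> [x|d T F mF]; first by case: ifP; rewrite // lee_fin.
by apply: measurable_fun_ifT; [exact: mP|exact: measurable_cst|exact: measurable_cst].
Qed.

Lemma admissible_box d (a b r : R) : (0 <= r)%R ->
  admissible (fun x => if [forall i : 'I_d, (a <= x i <= b)%R] then r%:E else 0).
Proof.
move=> r0; apply: admissible_if => // d' T F mF.
rewrite (_ : (fun _ => _) = (fun w => \big[andb/true]_(i < d) (a <= F w i <= b)%R)).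
  elim: (index_enum _) => [|i s IH].
    by rewrite (_ : (fun _ => _) = cst true) //; apply/funext => w; rewrite big_nil.
  rewrite (_ : (fun _ => _) = (fun w => (a <= F w i <= b)%R &&
      \big[andb/true]_(j <- s) (a <= F w j <= b)%R)); last first.
    by apply/funext => w; rewrite big_cons.
  apply: measurable_and => //; apply: measurable_and; apply: measurable_fun_ler => //.
by apply/funext => w; rewrite big_andE.
Qed.

Lemma nnreg_cst (r : R) : (0 <= r)%R -> nnreg (fun=> r).
Proof. by move=> r0; split=> //; exact: regular_cst. Qed.

Lemma admissible_ball :
  admissible (fun x : nat -> R => if (rsq m x <= 1)%R then 1%:E else 0).
Proof.
apply: admissible_if => // d T F mF.
by apply: measurable_fun_ler; [exact: measurable_rsq|exact: measurable_cst].
Qed.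

(** The two integrands differ only where [rsq] is [0]; that set lies in a cube of side [0], and
    [2 * m] is positive. *)
Lemma iint_cone1 : iint (2 * m) (cone (fun=> 1%R)) = ball_vol R m.
Proof.
have ao : admissible (fun x : nat -> R => if (rsq m x == 0)%R then 1%:E else 0).
  apply: admissible_if => // d T F mF.
  by apply: measurable_fun_eqr; [exact: measurable_rsq|exact: measurable_cst].
have -> : ball_vol R m = iint (2 * m) (fun x => cone (fun=> 1%R) x +
    (if (rsq m x == 0)%R then 1%:E else 0)).
  congr (iint _ _); apply/funext => x; rewrite /cone lt_def rsq_ge0 andbT.
  by case: eqVneq => [->|_] /=; rewrite ?ler01 ?add0e ?adde0.
rewrite iintD //; last exact/cone_admissible/nnreg_cst.
rewrite [X in _ + X](_ : _ = 0) ?adde0 //; apply/eqP.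
rewrite eq_le iint_ge0 // andbT.
apply: (@le_trans _ _ (iint (2 * m) (fun x : nat -> R =>
  if [forall i : 'I_(2 * m), (0 <= x i <= 0)%R] then 1%:E else 0))); last first.
  by rewrite iint_box // subr0 expr0n muln_eq0 (gtn_eqF m_gt0) /= mulr0.
apply: le_iint => // [|x]; first exact: admissible_box.
case: eqP => [/eqP x0|_]; last by case: ifP; rewrite // lee_fin ler01.
rewrite ifT //; apply/forallP => i.
move: x0; rewrite psumr_eq0 => [/allP/(_ i)|j _]; last exact: sqr_ge0.
by rewrite mem_index_enum sqrf_eq0 => /(_ isT)/eqP ->; rewrite lexx.
Qed.

Lemma ball_vol_lty : ball_vol R m < +oo.
Proof.
apply: (@le_lt_trans _ _ (iint (2 * m) (fun x : nat -> R =>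
  if [forall i : 'I_(2 * m), (- 1 <= x i <= 1)%R] then 1%:E else 0))).
  apply: le_iint => [||x]; [exact: admissible_ball|exact: admissible_box|].
  case: ifP => x1; last by case: ifP; rewrite // lee_fin ler01.
  rewrite ifT //; apply/forallP => i.
  rewrite -ler_norml -ler_sqr ?nnegrE ?normr_ge0 // expr1n real_normK ?num_real //.
  apply: le_trans x1; rewrite /rsq (bigD1 i) //= lerDl.
  by apply: sumr_ge0 => j _; exact: sqr_ge0.
by rewrite iint_box ?ltry // lerNl (le_trans _ ler01) // oppr_le0.
Qed.

Lemma ball_vol_gt0 : 0 < ball_vol R m.
Proof.
have d0 : (0 < (2 * m)%:R :> R)%R by rewrite ltr0n muln_gt0.
set d : R := (2 * m)%:R%R in d0 *.
(* The cube with side [1/d] in dimension [d] lies in the ball: each of the [d] squares is at most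
   [1/d]. *)
apply: (@lt_le_trans _ _ (iint (2 * m) (fun x : nat -> R =>
  if [forall i : 'I_(2 * m), (0 <= x i <= d^-1)%R] then 1%:E else 0))).
  rewrite iint_box ?invr_ge0 ?ler01 1?ltW // subr0 mul1r lte_fin.
  by rewrite exprn_gt0 // invr_gt0.
apply: le_iint => [||x]; [exact: admissible_box|exact: admissible_ball|].
case: ifP => [/forallP x1|_]; last by case: ifP; rewrite // lee_fin ler01.
rewrite ifT // (@le_trans _ _ (\sum_(i < 2 * m) d^-1)%R) //; last first.
  by rewrite sumr_const card_ord -mulr_natl mulfV // gt_eqF.
apply: ler_sum => i _; have /andP[x0 xd] := x1 i.
have d1 : (d^-1 <= 1)%R by rewrite invf_le1 // ler1n muln_gt0.
by rewrite expr2 (le_trans _ xd) // ler_piMr // (le_trans xd).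
Qed.

Lemma fine_ball_vol_gt0 : (0 < fine (ball_vol R m))%R.
Proof. by rewrite fine_gt0 // ball_vol_gt0 ball_vol_lty. Qed.

(** A real number, so that equations between integrals can be solved by ordinary algebra; [sph_fin]
    shows that no infinite value is lost for [nnreg] integrands. *)
Definition sph u : R := fine (sphere_int (fun z => (u z)%:E)).

Lemma sphere_intE u : sphere_int (fun z => (u z)%:E) =
  iint (2 * m) (cone u) * ((fine (ball_vol R m))^-1)%:E.
Proof. by []. Qed.

Lemma iint_cone_lty u : nnreg u -> iint (2 * m) (cone u) < +oo.
Proof.
move=> nu; have [C C0 HC] := regular_bounded nu.1.
apply: (@le_lt_trans _ _ (iint (2 * m) (fun x => C%:E * cone (fun=> 1%R) x))).
  apply: le_iint => [||x]; first exact: cone_admissible.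
    rewrite (_ : (fun _ => _) = cone (fun=> C)); last first.
      by apply/funext => x; rewrite /cone; case: ifP; rewrite ?mule1 ?mule0.
    exact/cone_admissible/nnreg_cst.
  rewrite /cone; case: ifP => [/andP[x0 _]|]; last by rewrite mule0.
  by rewrite mule1 lee_fin (le_trans (ler_norm _)) // HC // normalize_sphere.
rewrite iintZ //; last exact/cone_admissible/nnreg_cst.
by rewrite iint_cone1 lte_mul_pinfty // ball_vol_lty.
Qed.

Lemma sph_fin u : nnreg u -> sphere_int (fun z => (u z)%:E) = (sph u)%:E.
Proof.
move=> nu; rewrite /sph fineK // ge0_fin_numE.
  rewrite sphere_intE muleC lte_mul_pinfty ?iint_cone_lty //.
  by rewrite lee_fin invr_ge0 ltW // fine_ball_vol_gt0.
rewrite mule_ge0 ?lee_fin ?invr_ge0 ?(ltW fine_ball_vol_gt0) //.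
exact/iint_ge0/cone_admissible.
Qed.

Lemma eq_sph u v :
  (forall z, (\sum_(j < m) cabs2 (z j) = 1)%R -> u z = v z) -> sph u = sph v.
Proof.
move=> uv; rewrite /sph !sphere_intE; congr (fine (iint _ _ * _)).
apply/funext => x; rewrite /cone; case: ifP => // /andP[x0 _].
by rewrite uv // normalize_sphere.
Qed.

Lemma nnregD u v : nnreg u -> nnreg v -> nnreg (fun z => u z + v z)%R.
Proof.
by move=> [ru u0] [rv v0]; split=> [|z]; [exact: regularD|exact: addr_ge0].
Qed.

Lemma nnregZ (r : R) u : (0 <= r)%R -> nnreg u -> nnreg (fun z => r * u z)%R.
Proof.
move=> r0 [ru u0]; split=> [|z]; last exact: mulr_ge0.
by apply: regularM => //; exact: regular_cst.
Qed.

Lemma sphD u v : nnreg u -> nnreg v ->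
  sph (fun z => u z + v z)%R = (sph u + sph v)%R.
Proof.
move=> nu nv; apply: EFin_inj; rewrite EFinD -!sph_fin ?sphere_intE //; last exact: nnregD.
rewrite -muleDl ?ge0_adde_def ?inE ?iint_ge0 //; do ?exact: cone_admissible.
rewrite -iintD; do ?exact: cone_admissible.
congr (iint _ _ * _); apply/funext => x.
by rewrite /cone; case: ifP; rewrite ?adde0.
Qed.

Lemma sphZ (r : R) u : (0 <= r)%R -> nnreg u ->
  sph (fun z => r * u z)%R = (r * sph u)%R.
Proof.
move=> r0 nu; apply: EFin_inj; rewrite EFinM -!sph_fin ?sphere_intE //; last exact: nnregZ.
rewrite muleA -iintZ; do ?exact: cone_admissible; last by [].
congr (iint _ _ * _); apply/funext => x.
by rewrite /cone; case: ifP; rewrite ?mule0.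
Qed.

Lemma sph1 : sph (fun=> 1%R) = 1%R.
Proof.
apply: EFin_inj; rewrite -sph_fin; last exact: nnreg_cst.
rewrite sphere_intE iint_cone1 -[X in X * _]fineK; last first.
  by rewrite ge0_fin_numE ?ball_vol_lty // ltW // ball_vol_gt0.
by rewrite -EFinM mulfV // gt_eqF // fine_ball_vol_gt0.
Qed.


End SphereIntegral.

(** * Unitary symmetries of the sphere integral *)

Section SphereSymmetry.
Variables (R : realType) (m : nat).
Hypothesis m_gt0 : (0 < m)%N.
Implicit Types (x : nat -> R) (z : 'I_m -> R[i]) (u v : ('I_m -> R[i]) -> R).

Lemma rsq_plane_rot p q c s x : (p < 2 * m)%N -> (q < 2 * m)%N -> p != q ->
  c ^+ 2 + s ^+ 2 = 1 -> rsq m (plane_rot p q c s x) = rsq m x.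
Proof.
move=> pm qm pq cs; rewrite /rsq.
have qp : q != p by rewrite eq_sym.
rewrite (bigD1 (Ordinal pm)) // [RHS](bigD1 (Ordinal pm)) //=.
rewrite (bigD1 (Ordinal qm)) //= [in RHS](bigD1 (Ordinal qm)) //=.
rewrite /plane_rot upd_eq upd_neq // upd_eq !addrA; congr (_ + _); last first.
  apply: eq_bigr => i /andP[ip iq].
  by rewrite !upd_neq //; apply: contraNneq ip + apply: contraNneq iq;
    move=> e; exact/eqP/val_inj.
rewrite (_ : x p ^+ 2 + x q ^+ 2 = (c ^+ 2 + s ^+ 2) * (x p ^+ 2 + x q ^+ 2)); first by ring.
by rewrite cs mul1r.
Qed.

(** A rotation preserves [rsq], hence commutes with the radial projection and maps cones to
    cones. *)
Lemma sph_plane_rot p q c s u v : (p < 2 * m)%N -> (q < 2 * m)%N -> p != q ->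
  c ^+ 2 + s ^+ 2 = 1 -> nnreg u ->
  (forall x, v (toC x) = u (toC (plane_rot p q c s x))) -> sph v = sph u.
Proof.
move=> pm qm pq cs nu uv; rewrite /sph !sphere_intE.
rewrite -(iint_plane_rot pm qm pq cs (cone_admissible nu)).
congr (fine (iint _ _ * _)%E); apply/funext => x.
rewrite /cone /= rsq_plane_rot //; case: ifP => // _; rewrite uv.
congr ((u (toC _))%:E); apply/funext => i.
rewrite /normalize rsq_plane_rot // /plane_rot /upd.
by case: (i == p); last case: (i == q) => //; ring.
Qed.

Definition regularC (f : ('I_m -> R[i]) -> R[i]) :=
  regular (fun z => complex.Re (f z)) /\ regular (fun z => complex.Im (f z)).

Lemma eqC (a b : R[i]) : complex.Re a = complex.Re b ->
  complex.Im a = complex.Im b -> a = b.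
Proof. by case: a b => ? ? [? ?] /= -> ->. Qed.

Lemma regularC_cst a : regularC (fun=> a).
Proof. by split; exact: regular_cst. Qed.

Lemma regularC_coord j : regularC (fun z => z j).
Proof. by split; [exact: regular_re|exact: regular_im]. Qed.

Lemma regularCD f g : regularC f -> regularC g -> regularC (fun z => f z + g z).
Proof.
move=> [rf jf] [rg jg]; split.
- rewrite (_ : (fun _ => _) =
    (fun z => complex.Re (f z) + complex.Re (g z))); first exact: regularD.
  by apply/funext => z; case: (f z) (g z) => ? ? [].
- rewrite (_ : (fun _ => _) =
    (fun z => complex.Im (f z) + complex.Im (g z))); first exact: regularD.
  by apply/funext => z; case: (f z) (g z) => ? ? [].
Qed.

Lemma regularCM f g : regularC f -> regularC g -> regularC (fun z => f z * g z).
Proof.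
move=> [rf jf] [rg jg]; split.
- rewrite (_ : (fun _ => _) = (fun z => complex.Re (f z) * complex.Re (g z) +
    -1 * (complex.Im (f z) * complex.Im (g z)))); last first.
    by apply/funext => z; case: (f z) (g z) => ? ? [? ?] /=; rewrite mulN1r.
  by apply: regularD; apply: regularM => //; [exact: regular_cst|exact: regularM].
- rewrite (_ : (fun _ => _) = (fun z => complex.Re (f z) * complex.Im (g z) +
    complex.Im (f z) * complex.Re (g z))); last first.
    by apply/funext => z; case: (f z) (g z) => ? ? [? ?].
  by apply: regularD; exact: regularM.
Qed.

Lemma regularC_sum (I : Type) (s : seq I) (P : pred I) F :
  (forall i, regularC (F i)) -> regularC (fun z => \sum_(i <- s | P i) F i z).
Proof.
move=> rF; elim: s => [|i s IH].
  rewrite (_ : (fun _ => _) = fun=> 0); first exact: regularC_cst.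
  by apply/funext => z; rewrite big_nil.
case Pi: (P i).
  rewrite (_ : (fun _ => _) = fun z => F i z + \sum_(j <- s | P j) F j z).
    exact: regularCD.
  by apply/funext => z; rewrite big_cons Pi.
rewrite (_ : (fun _ => _) = fun z => \sum_(j <- s | P j) F j z) //.
by apply/funext => z; rewrite big_cons Pi.
Qed.

Lemma regularC_prod (I : Type) (s : seq I) F :
  (forall i, regularC (F i)) -> regularC (fun z => \prod_(i <- s) F i z).
Proof.
move=> rF; elim: s => [|i s IH].
  rewrite (_ : (fun _ => _) = fun=> 1); first exact: regularC_cst.
  by apply/funext => z; rewrite big_nil.
rewrite (_ : (fun _ => _) = fun z => F i z * \prod_(j <- s) F j z).
  exact: regularCM.
by apply/funext => z; rewrite big_cons.
Qed.

Lemma regularCX f n : regularC f -> regularC (fun z => f z ^+ n).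
Proof.
move=> rf; elim: n => [|n IH]; first exact: regularC_cst.
rewrite (_ : (fun _ => _) = fun z => f z * f z ^+ n); first exact: regularCM.
by apply/funext => z; rewrite exprS.
Qed.

Lemma regular_comp u (F : ('I_m -> R[i]) -> 'I_m -> R[i]) :
  regular u -> (forall j, regularC (fun z => F z j)) -> regular (fun z => u (F z)).
Proof.
move=> ru rF; elim: ru => [r|j|j|v w _ IHv _ IHw|v w _ IHv _ IHw] /=.
- exact: regular_cst.
- exact: (rF j).1.
- exact: (rF j).2.
- exact: regularD.
- exact: regularM.
Qed.

Lemma nnreg_cabs2 f : regularC f -> nnreg (fun z => cabs2 (f z)).
Proof.
move=> [rf jf]; split=> [|z]; last exact: cabs2_ge0.
rewrite (_ : (fun _ => _) = (fun z => complex.Re (f z) * complex.Re (f z) +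
  complex.Im (f z) * complex.Im (f z))); last by apply/funext => z; rewrite -!expr2.
by apply: regularD; exact: regularM.
Qed.

Definition phase (j : 'I_m) (c s : R) z : 'I_m -> R[i] :=
  fun k => if k == j then Complex c s * z k else z k.

Definition mix (i j : 'I_m) (c s : R) z : 'I_m -> R[i] :=
  fun k => if k == i then Complex c 0 * z i - Complex s 0 * z j
           else if k == j then Complex s 0 * z i + Complex c 0 * z j else z k.

Lemma ltn_double2 (j : 'I_m) : (2 * j < 2 * m)%N /\ ((2 * j).+1 < 2 * m)%N.
Proof. by have := ltn_ord j; split; lia. Qed.

Lemma sph_phase j c s u : c ^+ 2 + s ^+ 2 = 1 -> nnreg u ->
  sph (fun z => u (phase j c s z)) = sph u.
Proof.
move=> cs nu; have [j1 j2] := ltn_double2 j.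
apply: (sph_plane_rot j1 j2 _ cs nu); first by rewrite neq_ltn ltnSn.
move=> x; congr u; apply/funext => k; rewrite /phase /toC /plane_rot.
case: eqVneq => [->|kj].
  rewrite upd_eq upd_neq ?upd_eq; last by apply/eqP; lia.
  by apply: eqC => /=; ring.
have kj' : (k : nat) != j by apply: contraNneq kj => e; exact/eqP/val_inj.
rewrite !upd_neq //; apply/eqP; lia.
Qed.

(** Halfway to [mix]: only the real parts are rotated. A real plane rotation moves two of the [2m]
    real coordinates, so [mix] is one such rotation on the real parts and one on the imaginary
    parts. *)
Definition mix_re (i j : 'I_m) (c s : R) z : 'I_m -> R[i] :=
  fun k => if k == i then
      Complex (c * complex.Re (z i) - s * complex.Re (z j)) (complex.Im (z i))
    else if k == j then
      Complex (s * complex.Re (z i) + c * complex.Re (z j)) (complex.Im (z j))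
    else z k.

Lemma regularC_mix_re i j c s k : regularC (fun z => mix_re i j c s z k).
Proof.
have lin a b : regular (fun z => a * complex.Re (z i) + b * complex.Re (z j)).
  by apply: regularD; apply: regularM;
    [exact: regular_cst|exact: regular_re|exact: regular_cst|exact: regular_re].
rewrite /mix_re; case: (k == i); last case: (k == j); last exact: regularC_coord.
- split=> /=; last exact: regular_im.
  rewrite (_ : (fun _ => _) = fun z => c * complex.Re (z i) + (- s) * complex.Re (z j)) //.
  by apply/funext => z; rewrite mulNr.
- by split=> /=; [exact: lin|exact: regular_im].
Qed.

Lemma sph_mix i j c s u : i != j -> c ^+ 2 + s ^+ 2 = 1 -> nnreg u ->
  sph (fun z => u (mix i j c s z)) = sph u.
Proof.
move=> ij cs nu; have [i1 i2] := ltn_double2 i; have [j1 j2] := ltn_double2 j.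
have ij' : (i : nat) != j by apply: contraNneq ij => e; exact/eqP/val_inj.
have nv : nnreg (fun z => u (mix_re i j c s z)).
  split=> [|z]; last exact: nu.2.
  by apply: regular_comp nu.1 _ => k; exact: regularC_mix_re.
transitivity (sph (fun z => u (mix_re i j c s z))).
  apply: (sph_plane_rot i2 j2 _ cs nv); first by apply/eqP; lia.
  move=> x; congr u; apply/funext => k; rewrite /mix /mix_re /toC /plane_rot.
  case: eqVneq => [_|ki].
    rewrite upd_eq (@upd_neq _ _ (2 * i)%N); last by apply/eqP; lia.
    rewrite (@upd_neq _ _ (2 * i)%N); last by apply/eqP; lia.
    rewrite (@upd_neq _ _ (2 * j)%N); last by apply/eqP; lia.
    rewrite (@upd_neq _ _ (2 * j)%N); last by apply/eqP; lia.
    by apply: eqC => /=; ring.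
  have ki' : (k : nat) != i by apply: contraNneq ki => e; exact/eqP/val_inj.
  case: eqVneq => [_|kj].
    rewrite (@upd_neq _ _ (2 * i)%N); last by apply/eqP; lia.
    rewrite (@upd_neq _ _ (2 * i)%N); last by apply/eqP; lia.
    rewrite (@upd_neq _ _ (2 * j)%N); last by apply/eqP; lia.
    rewrite (@upd_neq _ _ (2 * j)%N); last by apply/eqP; lia.
    rewrite (@upd_neq _ _ (2 * j).+1); last by apply/eqP; lia.
    rewrite !upd_eq.
    by apply: eqC => /=; ring.
  have kj' : (k : nat) != j by apply: contraNneq kj => e; exact/eqP/val_inj.
  by rewrite !upd_neq //; apply/eqP; lia.
apply: (sph_plane_rot i1 j1 _ cs nu); first by apply/eqP; lia.
move=> x; congr u; apply/funext => k; rewrite /mix_re /toC /plane_rot.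
case: eqVneq => [->|ki].
  rewrite upd_eq (@upd_neq _ _ (2 * i).+1); last by apply/eqP; lia.
  by rewrite (@upd_neq _ _ (2 * i).+1) //; apply/eqP; lia.
have ki' : (k : nat) != i by apply: contraNneq ki => e; exact/eqP/val_inj.
case: eqVneq => [->|kj].
  rewrite (@upd_neq _ _ (2 * j)%N); last by apply/eqP; lia.
  rewrite upd_eq (@upd_neq _ _ (2 * j).+1); last by apply/eqP; lia.
  by rewrite (@upd_neq _ _ (2 * j).+1) //; apply/eqP; lia.
have kj' : (k : nat) != j by apply: contraNneq kj => e; exact/eqP/val_inj.
by rewrite !upd_neq //; apply/eqP; lia.
Qed.

End SphereSymmetry.

(** * Multi-indices and the finite sets of given degree *)

Section MultiIndex.
Variable m : nat.
Implicit Types (n p : mi m) (i j : 'I_m).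

Definition mshift i (k : nat) n : mi m := [ffun l => (n l + k * (l == i))%N].

Lemma mshiftE i k n l : mshift i k n l = (n l + k * (l == i))%N.
Proof. by rewrite ffunE. Qed.

Lemma mdeg_shift i k n : mdeg (mshift i k n) = (mdeg n + k)%N.
Proof.
rewrite /mdeg; under eq_bigr => l _ do rewrite mshiftE.
rewrite big_split /=; congr addn; rewrite (bigD1 i) //= eqxx muln1.
by rewrite big1 ?addn0 // => l /negbTE ->; rewrite muln0.
Qed.

Lemma mfact_gt0 n : (0 < mfact n)%N.
Proof. by rewrite prodn_gt0 // => i; exact: fact_gt0. Qed.

Lemma mfact_shift1 i n : mfact (mshift i 1 n) = ((n i).+1 * mfact n)%N.
Proof.
rewrite /mfact (bigD1 i) //= [in RHS](bigD1 i) //= mshiftE eqxx addn1 factS.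
rewrite mulnA; congr muln; apply: eq_bigr => l /negbTE li.
by rewrite mshiftE li addn0.
Qed.

Definition mzero : mi m := [ffun=> 0%N].

Lemma mdeg0 : mdeg mzero = 0%N.
Proof. by rewrite /mdeg big1 // => i _; rewrite ffunE. Qed.

Lemma mfact0 : mfact mzero = 1%N.
Proof. by rewrite /mfact big1 // => i _; rewrite ffunE. Qed.

Lemma mdeg_eq0 n : mdeg n = 0%N -> n = mzero.
Proof.
move=> /eqP; rewrite /mdeg sum_nat_eq0 => /forallP n0.
by apply/ffunP => i; rewrite ffunE; apply/eqP; exact: n0.
Qed.

Lemma mpred_shift i n : mpred i (mshift i 1 n) = n.
Proof. by apply/ffunP => l; rewrite !ffunE mul1n addnK. Qed.

Lemma mshift_pred i n : (0 < n i)%N -> mshift i 1 (mpred i n) = n.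
Proof.
move=> ni; apply/ffunP => l; rewrite !ffunE mul1n subnK //.
by case: eqP => // ->.
Qed.

Lemma mshift_shift i k l n : mshift i k (mshift i l n) = mshift i (k + l) n.
Proof. by apply/ffunP => q; rewrite !ffunE -addnA -mulnDl (addnC l). Qed.

Lemma mshiftC i j k l n : mshift i k (mshift j l n) = mshift j l (mshift i k n).
Proof. by apply/ffunP => q; rewrite !ffunE addnAC. Qed.

Lemma mshift0 i n : mshift i 0 n = n.
Proof. by apply/ffunP => q; rewrite !ffunE mul0n addn0. Qed.

Lemma mdeg_pred i n : (0 < n i)%N -> mdeg (mpred i n) = (mdeg n).-1.
Proof. by move=> ni; rewrite -{2}(mshift_pred ni) mdeg_shift addn1. Qed.

(** The index set of [hom_eval], with its bounded exponents turned into plain multi-indices. *)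
Definition hom_index (k : nat) : seq (mi m) :=
  [seq [ffun i => (q i : nat)] | q : {ffun 'I_m -> 'I_k.+1} <-
    enum [pred q : {ffun 'I_m -> 'I_k.+1} | (\sum_(i < m) (q i : nat) == k)%N]].

Lemma hom_index_uniq k : uniq (hom_index k).
Proof.
rewrite map_inj_uniq ?enum_uniq // => q q' /ffunP e; apply/ffunP => i.
by apply: val_inj; have := e i; rewrite !ffunE.
Qed.

Lemma mem_hom_index k n : (n \in hom_index k) = (mdeg n == k).
Proof.
apply/mapP/eqP => [[q + ->]|nk].
  rewrite mem_enum inE => /eqP qk; rewrite -[RHS]qk.
  by apply: eq_bigr => i _; rewrite ffunE.
have le i : (n i < k.+1)%N by rewrite ltnS -nk /mdeg (bigD1 i) //= leq_addr.
exists [ffun i => Ordinal (le i)]; last by apply/ffunP => i; rewrite !ffunE.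
by rewrite mem_enum inE; apply/eqP; rewrite -[RHS]nk; apply: eq_bigr => i _; rewrite ffunE.
Qed.

Lemma sum_hom_index (V : nmodType) (k : nat) (F : mi m -> V) :
  \sum_(q : {ffun 'I_m -> 'I_k.+1} | (\sum_(i < m) (q i : nat) == k)%N)
     F [ffun i => (q i : nat)] = \sum_(n <- hom_index k) F n.
Proof. by rewrite big_map big_enum. Qed.

End MultiIndex.

(** * Solving the plane relation: such a family is [n!] times a function of the degree *)

Section PlaneRelation.
Variables (R : realType) (m : nat) (D : mi m -> R).

(* This is how the squared norms of the monomials transform under the rotation
   [z_i -> c z_i + s z_j] when the monomials are orthogonal. *)
Definition plane_relation := forall (i j : 'I_m) (p : mi m) (r : nat) (c s : R),
  i != j -> p i = 0%N -> p j = 0%N -> 0 < c -> 0 < s -> c ^+ 2 + s ^+ 2 = 1 ->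
  D (mshift i r p) = \sum_(l < r.+1) 'C(r, l)%:R ^+ 2 * (c ^+ 2) ^+ l *
    (s ^+ 2) ^+ (r - l) * D (mshift i l (mshift j (r - l) p)).

Hypothesis rel : plane_relation.

(** With [c^2 = t/(t+1)] and [s^2 = 1/(t+1)], multiplication by [(t+1)^r] makes both sides
    polynomials in [t] that agree for all [t > 0]; the claim compares their coefficients of
    [t^l]. *)
Lemma plane_relation_coef (i j : 'I_m) (p : mi m) r l :
  i != j -> p i = 0%N -> p j = 0%N -> (l <= r)%N ->
  D (mshift i r p) = 'C(r, l)%:R * D (mshift i l (mshift j (r - l) p)).
Proof.
move=> ij pi pj lr.
pose a l := D (mshift i l (mshift j (r - l) p)).
pose P : {poly R} :=
  \poly_(l < r.+1) ('C(r, l)%:R * D (mshift i r p) - 'C(r, l)%:R ^+ 2 * a l).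
have Pt (t : R) : 0 < t -> P.[t] = 0.
  move=> t0; have t1 : 0 < t + 1 by rewrite addr_gt0.
  have q1 : 0 < t / (t + 1) by rewrite divr_gt0.
  have q2 : 0 < (t + 1)^-1 by rewrite invr_gt0.
  rewrite horner_poly; under eq_bigr => k _ do rewrite mulrBl.
  rewrite sumrB; apply/eqP; rewrite subr_eq0; apply/eqP.
  transitivity (D (mshift i r p) * (t + 1) ^+ r).
    rewrite exprD1n mulr_sumr; apply: eq_bigr => k _.
    by rewrite -mulr_natl; ring.
  have cs : Num.sqrt (t / (t + 1)) ^+ 2 + Num.sqrt (t + 1)^-1 ^+ 2 = 1.
    by rewrite !sqr_sqrtr ?ltW // -[X in _ + X]mul1r -mulrDl mulfV // gt_eqF.
  rewrite (rel r ij pi pj _ _ cs) ?sqrtr_gt0 // !sqr_sqrtr ?ltW //.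
  rewrite mulr_suml; apply: eq_bigr => k _.
  have kr : (k <= r)%N by rewrite -ltnS.
  rewrite -[in X in _ * X](subnKC kr) exprD expr_div_n exprVn.
  have e1 : (t + 1) ^- k * (t + 1) ^+ k = 1 by rewrite mulVf // expf_neq0 ?gt_eqF.
  have e2 : (t + 1) ^- (r - k) * (t + 1) ^+ (r - k) = 1.
    by rewrite mulVf // expf_neq0 ?gt_eqF.
  set x := (t + 1) ^- k in e1 *; set X := (t + 1) ^+ k in e1 *.
  set y := (t + 1) ^- _ in e2 *; set Y := (t + 1) ^+ _ in e2 *.
  rewrite [LHS](_ : _ = (x * X) * (y * Y) * ('C(r, k)%:R ^+ 2 * a k * t ^+ k)).
    by rewrite e1 e2 !mul1r.
  by rewrite /a; ring.
have P0 : P = 0.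
  apply/eqP; apply: contraT => Pn0.
  (* A non-zero [P] has fewer than [size P] roots, and these are [size P] distinct positive ones. *)
  pose s := [seq (k.+1)%:R | k <- iota 0 (size P)] : seq R.
  have := max_poly_roots Pn0 (rs := s).
  rewrite size_map size_iota ltnn => -> //.
  - by apply/allP => x /mapP[k _ ->]; rewrite rootE Pt.
  - rewrite map_inj_uniq ?iota_uniq // => x y /eqP.
    by rewrite eqr_nat eqSS => /eqP.
have := congr1 (fun Q : {poly R} => Q`_l) P0.
rewrite coef_poly ltnS lr coef0 expr2 -mulrA -mulrBr => /eqP.
rewrite mulf_eq0 pnatr_eq0 eqn0Ngt bin_gt0 lr /= subr_eq0 => /eqP -> //.
Qed.

(** The binomial factor of [plane_relation_coef], for [r = n i + n j] and [l = n i], is exactly the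
    quotient of the two factorials. *)
Lemma plane_relation_ratio (i j : 'I_m) (n : mi m) : i != j ->
  exists2 n' : mi m, n' j = 0%N /\ n' = [ffun l =>
    if l == i then (n i + n j)%N else if l == j then 0%N else n l] &
  D n / (mfact n)%:R = D n' / (mfact n')%:R.
Proof.
move=> ij; have ji : (j == i) = false by rewrite eq_sym (negbTE ij).
pose p : mi m := [ffun l => if (l == i) || (l == j) then 0%N else n l].
have pi : p i = 0%N by rewrite ffunE eqxx.
have pj : p j = 0%N by rewrite ffunE eqxx orbT.
have nE : n = mshift i (n i) (mshift j (n j) p).
  apply/ffunP => l; rewrite !ffunE.
  case: (eqVneq l i) => [->|li] /=; first by rewrite (negbTE ij) muln0 muln1.
  by case: (eqVneq l j) => [->|lj] /=; rewrite ?muln0 ?muln1 ?addn0.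
set n' := [ffun l => _].
have n'E : n' = mshift i (n i + n j) p.
  apply/ffunP => l; rewrite !ffunE.
  case: (eqVneq l i) => [->|li] /=; first by rewrite muln1.
  by rewrite muln0 addn0.
exists n'; first by rewrite ffunE ji eqxx.
have fact2 (q : mi m) : mfact q = ((q i)`! * (q j)`! *
    \prod_(l < m | (l != i) && (l != j)) (q l)`!)%N.
  by rewrite /mfact (bigD1 i) //= (bigD1 j) //= ?ji // mulnA.
have -> : D n' = 'C(n i + n j, n i)%:R * D n.
  by rewrite n'E (plane_relation_coef ij pi pj (leq_addr _ _)) addKn -nE.
have n'i : n' i = (n i + n j)%N by rewrite ffunE eqxx.
have n'j : n' j = 0%N by rewrite ffunE ji eqxx.
have rest : (\prod_(l < m | (l != i) && (l != j)) (n' l)`! =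
    \prod_(l < m | (l != i) && (l != j)) (n l)`!)%N.
  by apply: eq_bigr => l /andP[/negbTE li /negbTE lj]; rewrite ffunE li lj.
rewrite !fact2 n'i n'j rest fact0 muln1.
set q := \prod_(l < m | _) _.
have q0 : (q%:R != 0 :> R).
  by rewrite pnatr_eq0 -lt0n prodn_gt0 // => l; exact: fact_gt0.
have := bin_fact (leq_addr (n j) (n i)); rewrite addKn => <-.
have f0 k : (k`!%:R != 0 :> R) by rewrite pnatr_eq0 -lt0n fact_gt0.
have b0 : ('C(n i + n j, n i)%:R != 0 :> R).
  by rewrite pnatr_eq0 -lt0n bin_gt0 leq_addr.
by rewrite !natrM; field; rewrite !f0 b0 q0.
Qed.

Lemma plane_relationP : (0 < m)%N ->
  exists C : nat -> R, forall n, D n = C (mdeg n) * (mfact n)%:R.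
Proof.
move=> m0; pose i0 := Ordinal m0.
pose e k : mi m := mshift i0 k (mzero m).
exists (fun k => D (e k) / (mfact (e k))%:R) => n.
have f0 (q : mi m) : ((mfact q)%:R != 0 :> R).
  by rewrite pnatr_eq0 -lt0n mfact_gt0.
suff <- : D n / (mfact n)%:R = D (e (mdeg n)) / (mfact (e (mdeg n)))%:R.
  by rewrite divfK.
(* Induction on the part of the degree outside coordinate [i0]; each step empties one further
   coordinate into [i0]. *)
move: {2}(mdeg n - n i0)%N (leqnn (mdeg n - n i0)) => N.
elim: N n => [|N IH] n.
  rewrite leqn0 subn_eq0 => deg.
  suff -> : n = e (mdeg n) by rewrite mdeg_shift mdeg0 add0n.
  have dE : mdeg n = n i0.
    by apply/eqP; rewrite eqn_leq deg /mdeg (bigD1 i0) //= leq_addr.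
  move: (dE); rewrite /mdeg (bigD1 i0) //= => /eqP.
  rewrite -[X in _ == X]addn0 eqn_add2l sum_nat_eq0 => /forallP n0.
  apply/ffunP => l; rewrite !ffunE add0n.
  case: (eqVneq l i0) => [->|li]; last first.
    by rewrite muln0; apply/eqP; have := n0 l; rewrite li.
  by rewrite muln1 big1 ?addn0 // => k ki; apply/eqP; have := n0 k; rewrite ki.
rewrite leq_eqVlt => /predU1P[dN|]; last by rewrite ltnS; exact: IH.
have [j ji nj] : exists2 j, j != i0 & (0 < n j)%N.
  case: (boolP [exists j, (j != i0) && (0 < n j)%N]).
    by case/existsP => j /andP[? ?]; exists j.
  rewrite negb_exists => /forallP n0; move: dN.
  rewrite /mdeg (bigD1 i0) //= big1 ?addn0 ?subnn // => k ki.
  by have := n0 k; rewrite ki /= -eqn0Ngt => /eqP.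
have ij : i0 != j by rewrite eq_sym.
have [n' [n'j n'E] ->] := plane_relation_ratio n ij.
have degE : mdeg n' = mdeg n.
  rewrite /mdeg (bigD1 i0) //= (bigD1 j) //= [RHS](bigD1 i0) //= [in RHS](bigD1 j) //=.
  rewrite n'j n'E ffunE eqxx add0n addnA; congr addn; apply: eq_bigr => l /andP[li lj].
  by rewrite ffunE (negbTE li) (negbTE lj).
rewrite IH ?degE // n'E ffunE eqxx; move: dN nj; lia.
Qed.

End PlaneRelation.

(** * Orthogonality of the monomials on the sphere *)

Section SphereMonomials.
Variables (R : realType) (m : nat).
Hypothesis m_gt0 : (0 < m)%N.
Implicit Types (z : 'I_m -> R[i]) (n : mi m).

Lemma cabs2M (a b : R[i]) : cabs2 (a * b) = cabs2 a * cabs2 b.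
Proof. by case: a b => ? ? [? ?]; rewrite /cabs2 /=; ring. Qed.

Lemma cabs2X (a : R[i]) k : cabs2 (a ^+ k) = cabs2 a ^+ k.
Proof.
elim: k => [|k IH]; last by rewrite !exprS cabs2M IH.
by rewrite !expr0 /cabs2 /= expr1n expr0n addr0.
Qed.

Lemma cabs20 : cabs2 (0 : R[i]) = 0.
Proof. by rewrite /cabs2 /= expr0n addr0. Qed.

Lemma cabs2_real (x : R) : cabs2 (Complex x 0) = x ^+ 2.
Proof. by rewrite /cabs2 /= expr0n addr0. Qed.

Definition zmon n z : R[i] := \prod_(j < m) z j ^+ n j.

Lemma zmon_shift i k n z : zmon (mshift i k n) z = z i ^+ k * zmon n z.
Proof.
rewrite /zmon (bigD1 i) //= [in RHS](bigD1 i) //= mshiftE eqxx muln1 addnC exprD.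
rewrite -mulrA; congr (_ * (_ * _)); apply: eq_bigr => l /negbTE li.
by rewrite mshiftE li muln0 addn0.
Qed.

Lemma zmon_phase j c s n z :
  zmon n (phase j c s z) = Complex c s ^+ n j * zmon n z.
Proof.
rewrite /zmon (bigD1 j) //= [in RHS](bigD1 j) //= /phase eqxx exprMn mulrA.
by congr (_ * _); apply: eq_bigr => l /negbTE ->.
Qed.

Lemma regularC_zmon n : regularC (zmon n).
Proof. by apply: regularC_prod => j; apply: regularCX; exact: regularC_coord. Qed.

Definition zpoly (s : seq (mi m)) (a : mi m -> R[i]) z : R[i] :=
  \sum_(n <- s) a n * zmon n z.

Lemma regularC_zpoly s a : regularC (zpoly s a).
Proof.
apply: regularC_sum => n; apply: regularCM; first exact: regularC_cst.
exact: regularC_zmon.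
Qed.

(** The root is the point of the unit circle at angle [pi / 2^t]; de Moivre's formula gives its
    power. *)
Lemma complex_rootN1 t : exists c s : R,
  c ^+ 2 + s ^+ 2 = 1 /\ Complex c s ^+ (2 ^ t) = -1.
Proof.
exists (cos (pi / 2 ^+ t)), (sin (pi / 2 ^+ t)); split; first exact: cos2Dsin2.
have moivre (th : R) k : Complex (cos th) (sin th) ^+ k =
    Complex (cos (th *+ k)) (sin (th *+ k)).
  elim: k => [|k IH]; first by rewrite mulr0n cos0 sin0 expr0.
  by rewrite exprS IH mulrS cosD sinD; apply: eqC => /=; ring.
rewrite moivre (_ : pi / 2 ^+ t *+ 2 ^ t = pi) ?cospi ?sinpi; last first.
  by rewrite -[LHS]mulr_natr natrX divfK // expf_neq0 // pnatr_eq0.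
by apply: eqC => /=; rewrite ?oppr0.
Qed.

(** Equal norms of [f + g] and [f - g] stand in for a vanishing real part of the inner product, so
    only non-negative functions are integrated. *)
Lemma sph_parallelogram (f g : ('I_m -> R[i]) -> R[i]) :
  regularC f -> regularC g ->
  sph (fun z => cabs2 (f z + g z)) = sph (fun z => cabs2 (f z - g z)) ->
  sph (fun z => cabs2 (f z + g z)) =
    sph (fun z => cabs2 (f z)) + sph (fun z => cabs2 (g z)).
Proof.
move=> rf rg e.
have rD : nnreg (fun z => cabs2 (f z + g z)) by apply/nnreg_cabs2/regularCD.
have rB : nnreg (fun z => cabs2 (f z - g z)).
  apply: nnreg_cabs2; apply: (@regularCD _ _ f (fun z => - g z)) => //.
  rewrite (_ : (fun _ => _) = fun z => -1 * g z).
    by apply: regularCM => //; exact: regularC_cst.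
  by apply/funext => z; rewrite mulN1r.
have nf := nnreg_cabs2 rf; have ng := nnreg_cabs2 rg.
have : sph (fun z => cabs2 (f z + g z) + cabs2 (f z - g z)) =
    sph (fun z => 2 * cabs2 (f z) + 2 * cabs2 (g z)).
  apply: eq_sph => z _; case: (f z) (g z) => ? ? [? ?].
  by rewrite /cabs2 /=; ring.
have n2f := nnregZ (ler0n R 2) nf; have n2g := nnregZ (ler0n R 2) ng.
rewrite (sphD m_gt0 rD rB) (sphD m_gt0 n2f n2g).
rewrite (sphZ m_gt0 (ler0n R 2) nf) (sphZ m_gt0 (ler0n R 2) ng) -e; lra.
Qed.

Lemma zpoly_split s (P : pred (mi m)) a z : zpoly s a z =
  zpoly [seq n <- s | P n] a z + zpoly [seq n <- s | ~~ P n] a z.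
Proof. by rewrite /zpoly (bigID P) !big_filter. Qed.

Definition mono_norm2 n : R := sph (fun z => cabs2 (zmon n z)).

(* Rotating the phase of [z_j] by a [2^t]-th root of [-1], where [t] is the
   lowest bit on which the exponents of [z_j] differ, changes the sign of one
   part of the sum; by the parallelogram law the two parts are orthogonal. *)
Lemma sph_orthogonal s a : uniq s -> sph (fun z => cabs2 (zpoly s a z)) =
  \sum_(n <- s) cabs2 (a n) * mono_norm2 n.
Proof.
elim: {s}(size s) {-2}s (leqnn (size s)) => [|N IH] s.
  rewrite leqn0 size_eq0 => /eqP -> _; rewrite big_nil.
  transitivity (sph (fun z : 'I_m -> R[i] => 0 * (1:R))).
    by apply: eq_sph => z _; rewrite /zpoly big_nil cabs20 mul0r.
  by rewrite sphZ ?mul0r //; exact: nnreg_cst.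
move=> sN us; case: s sN us => [|n0 s0] sN us; first exact: IH.
set s := n0 :: s0 in sN us *.
have [/allP alln0|] := boolP (all (pred1 n0) s0).
  have s00 : s0 = [::].
    case: s0 @s sN us alln0 => // n1 s1 s sN /= /andP[+ _] /(_ n1).
    by rewrite inE !inE eqxx => /norP[/eqP n01 _] /(_ isT)/eqP n10; case: n01.
  rewrite /s s00 big_seq1 -sphZ ?cabs2_ge0 //; last first.
    exact/nnreg_cabs2/regularC_zmon.
  by apply: eq_sph => z _; rewrite /zpoly big_seq1 cabs2M.
move=> /allPn[n1 n1s /= n10].
have n1s' : n1 \in s by rewrite inE n1s orbT.
have n0s : n0 \in s by rewrite inE eqxx.
have [j nj] : exists j, n1 j != n0 j.
  apply/existsP; apply: contraNT n10; rewrite negb_exists => /forallP e.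
  by apply/eqP/ffunP => j; have := e j; rewrite negbK => /eqP.
pose agree t := all (fun n => n j == n0 j %[mod 2 ^ t]) s.
(* The power [2^t] exceeds both exponents for this [t], so reduction modulo it cannot identify
   them. *)
have ex : exists t, ~~ agree t.
  exists (maxn (n1 j) (n0 j)); apply/allPn; exists n1 => //.
  rewrite !modn_small //; apply: leq_ltn_trans (ltn_expl _ (ltnSn 1)).
    exact: leq_maxr.
  exact: leq_maxl.
(* The least failing power is [t + 1], since all numbers agree modulo [1]; hence the exponents agree
   on the bits below [t] but not on bit [t], whose parity defines [P]. *)
case: (ex_minnP ex) => [[|t] bad least].
  by case/allPn: bad => n _; rewrite !expn0 !modn1.
have good : agree t by apply: contraT => /least; rewrite ltnn.
pose r := (n0 j %% 2 ^ t)%N.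
have decomp n : n \in s -> n j = (n j %/ 2 ^ t * 2 ^ t + r)%N.
  by move=> /(allP good) /eqP e; rewrite /r -e -divn_eq.
pose P := [pred n : mi m | odd (n j %/ 2 ^ t)].
have [c [w [cw root]]] := complex_rootN1 t.
have flip n : n \in s -> Complex c w ^+ n j = Complex c w ^+ r * (-1) ^+ P n.
  by move=> ns; rewrite (decomp n ns) exprD mulnC exprM root mulrC signr_odd.
(* Both parts are shorter than [s] because neither is all of it, so the induction hypothesis applies
   to each. *)
have sizes (Q : pred (mi m)) : (exists2 n, n \in s & ~~ Q n) ->
    (size [seq n <- s | Q n] <= N)%N.
  move=> [n ns nQ]; rewrite -ltnS (leq_trans _ sN) // size_filter ltn_neqAle count_size andbT.
  by apply: contraNneq nQ => /eqP; rewrite -all_count => /allP /(_ n ns).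
have mixed : exists n n', [/\ n \in s, n' \in s & P n != P n'].
  case/allPn: bad => n ns nn0; exists n, n0; split => //.
  apply: contraNneq nn0 => Pn; apply/eqP.
  rewrite (decomp n ns) (decomp n0 n0s) expnSr.
  have step q : (q * 2 ^ t + r = q./2 * (2 ^ t * 2) + (odd q * 2 ^ t + r))%N.
    by rewrite -{1}(odd_double_half q) -muln2; ring.
  rewrite (step (n j %/ 2 ^ t)%N) (step (n0 j %/ 2 ^ t)%N) !modnMDl.
  by move: Pn => /= ->.
have [n [n' [ns n's Pn Pn']]] : exists n n', [/\ n \in s, n' \in s, P n & ~~ P n'].
  case: mixed => n [n' [ns n's]]; case Pn: (P n) => Pn'.
    by exists n, n'; split => //; move: Pn'; case: (P n').
  by exists n', n; split => //; [move: Pn'; case: (P n')|rewrite Pn].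
pose f := zpoly [seq n <- s | P n] a; pose g := zpoly [seq n <- s | ~~ P n] a.
have -> : sph (fun z => cabs2 (zpoly s a z)) = sph (fun z => cabs2 (g z + f z)).
  by apply: eq_sph => z _; rewrite (@zpoly_split _ P) addrC.
have cabs2w : cabs2 (Complex c w) = 1 by [].
rewrite sph_parallelogram; do ?exact: regularC_zpoly.
  rewrite /f /g !IH ?filter_uniq //; first by
      rewrite !big_filter [RHS](bigID P) addrC.
  - by apply: sizes; exists n'.
  - by apply: sizes; exists n => //; rewrite negbK.
rewrite -(sph_phase m_gt0 j cw); last first.
  exact/nnreg_cabs2/regularCD/regularC_zpoly/regularC_zpoly.
apply: eq_sph => z _.
have phaseE Q : zpoly [seq n <- s | Q n] a (phase j c w z) =
    \sum_(n <- s | Q n) (Complex c w ^+ r * (-1) ^+ P n) * (a n * zmon n z).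
  rewrite /zpoly big_filter big_seq_cond [RHS]big_seq_cond.
  by apply: eq_bigr => k /andP[ks _]; rewrite zmon_phase flip //; ring.
(* The exponents share the residue [r], so the phase rotation yields a common unimodular factor
   besides the sign on [f]. *)
rewrite (_ : _ + _ = Complex c w ^+ r * (g z - f z)).
  by rewrite cabs2M cabs2X cabs2w expr1n mul1r.
rewrite /f /g !phaseE /zpoly !big_filter mulrBr !mulr_sumr -sumrN.
by congr (_ + _); apply: eq_bigr => k /= Pk; rewrite ?Pk ?(negbTE Pk); ring.
Qed.

End SphereMonomials.

(** * Exact norms of the monomials on the sphere *)

Section SphereNorms.
Variables (R : realType) (m : nat).
Hypothesis m_gt0 : (0 < m)%N.
Implicit Types (z : 'I_m -> R[i]) (n : mi m).

Lemma mono_norm2_nnreg n : nnreg (fun z : 'I_m -> R[i] => cabs2 (zmon n z)).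
Proof. exact/nnreg_cabs2/regularC_zmon. Qed.

(** Rotation invariance, the binomial theorem for [(c z_i + s z_j)^r], and orthogonality of the
    resulting terms. *)
Lemma mono_norm2_rel : plane_relation (@mono_norm2 R m).
Proof.
move=> i j p r c s ij pi pj _ _ cs.
have ji : (j == i) = false by rewrite eq_sym (negbTE ij).
(* [mix] sends [z_i] to [c z_i - s z_j], hence the sign of [s]. *)
rewrite /mono_norm2 -(sph_mix (c := c) (s := - s) m_gt0 ij); last 2 first.
- by rewrite sqrrN.
- exact: mono_norm2_nnreg.
pose t := [seq mshift i l (mshift j (r - l) p) | l <- index_iota 0 r.+1].
pose a (q : mi m) : R[i] :=
  'C(r, q i)%:R * Complex c 0 ^+ q i * Complex s 0 ^+ (r - q i).
have idx l : mshift i l (mshift j (r - l) p) i = l.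
  by rewrite !mshiftE pi eqxx eq_sym ji muln0 muln1.
have ut : uniq t.
  rewrite map_inj_uniq ?iota_uniq // => k l /(congr1 (fun q : mi m => q i)).
  by rewrite !idx.
transitivity (sph (fun z => cabs2 (zpoly t a z))).
  apply: eq_sph => z _; congr cabs2.
  have zp : zmon p (mix i j c (- s) z) = zmon p z.
    apply: eq_bigr => k _; rewrite /mix.
    case: (eqVneq k i) => [->|_]; first by rewrite pi !expr0.
    by case: (eqVneq k j) => [->|_] //; rewrite pj !expr0.
  rewrite zmon_shift zp /mix eqxx.
  rewrite (_ : _ - _ = Complex s 0 * z j + Complex c 0 * z i); last first.
    by rewrite addrC; congr (_ + _); rewrite -mulNr; congr (_ * _); apply: eqC;
      rewrite /= ?opprK ?oppr0.
  rewrite exprDn mulr_suml /zpoly big_map.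
  rewrite big_mkord; apply: eq_bigr => l _.
  rewrite /a idx !zmon_shift !exprMn -mulr_natl; ring.
rewrite sph_orthogonal // big_map.
rewrite big_mkord; apply: eq_bigr => l _.
rewrite /a idx !cabs2M !cabs2X !cabs2_real (_ : cabs2 _%:R = 'C(r, l)%:R ^+ 2) //.
by rewrite -cabs2_real; congr cabs2; rewrite -(rmorph_nat (real_complex R)).
Qed.

Lemma sph_sum (I : Type) (s : seq I) (F : I -> ('I_m -> R[i]) -> R) :
  (forall i, nnreg (F i)) ->
  nnreg (fun z => \sum_(i <- s) F i z) /\
  sph (fun z => \sum_(i <- s) F i z) = \sum_(i <- s) sph (F i).
Proof.
move=> nF; elim: s => [|i s [IH1 IH2]].
  rewrite big_nil; split.
    rewrite (_ : (fun _ => _) = fun=> 0); first exact: nnreg_cst.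
    by apply/funext => z; rewrite big_nil.
  transitivity (sph (fun z : 'I_m -> R[i] => 0 * (1:R))).
    by apply: eq_sph => z _; rewrite big_nil mul0r.
  by rewrite sphZ ?mul0r //; exact: nnreg_cst.
have e : (fun z => \sum_(j <- i :: s) F j z) =
    (fun z => F i z + \sum_(j <- s) F j z).
  by apply/funext => z; rewrite big_cons.
rewrite e big_cons; split; first exact: nnregD.
by rewrite sphD // IH2.
Qed.

(** The squared moduli of the coordinates sum to [1] on the sphere. *)
Lemma sum_mono_norm2 n : \sum_(i < m) mono_norm2 R (mshift i 1 n) = mono_norm2 R n.
Proof.
rewrite /mono_norm2.
have [_ <-] := sph_sum (index_enum 'I_m) (fun i => mono_norm2_nnreg (mshift i 1 n)).
apply: eq_sph => z z1; rewrite -[RHS]mul1r -z1 mulr_suml.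
by apply: eq_bigr => i _; rewrite zmon_shift cabs2M expr1.
Qed.

Lemma mono_norm2_0 : mono_norm2 R (mzero m) = 1.
Proof.
rewrite -(sph1 R m_gt0); apply: eq_sph => z _.
rewrite /zmon big1 => [|i _]; last by rewrite ffunE expr0.
by rewrite /cabs2 /= expr1n expr0n addr0.
Qed.

Lemma mono_norm2E n : mono_norm2 R n =
  (m.-1)`!%:R * (mfact n)%:R / (m.-1 + mdeg n)`!%:R.
Proof.
have [C CE] := plane_relationP mono_norm2_rel m_gt0.
have f0 (q : nat) : (q`!%:R != 0 :> R) by rewrite pnatr_eq0 -lt0n fact_gt0.
rewrite CE mulrAC; congr (_ * _).
suff -> k : C k = (m.-1)`!%:R / (m.-1 + k)`!%:R by [].
(* For a multi-index of degree [k], [sum_mono_norm2] becomes [(k + m) C(k+1) = C(k)], and the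
   constant function gives [C(0) = 1]. *)
elim: k => [|k IH].
  have := CE (mzero m); rewrite mono_norm2_0 mdeg0 mfact0 mulr1 => <-.
  by rewrite addn0 divff.
pose e : mi m := mshift (Ordinal m_gt0) k (mzero m).
have dege : mdeg e = k by rewrite mdeg_shift mdeg0.
have := sum_mono_norm2 e; rewrite CE dege.
under eq_bigr => i _ do rewrite CE mdeg_shift dege mfact_shift1 natrM mulrA.
have e0 : ((mfact e)%:R != 0 :> R) by rewrite pnatr_eq0 -lt0n mfact_gt0.
rewrite -mulr_suml => /(mulIf e0).
rewrite -mulr_sumr -natr_sum (_ : \sum_i (e i).+1 = k + m)%N; last first.
  under eq_bigr => i _ do rewrite -addn1.
  by rewrite big_split /= -/(mdeg e) dege sum1_card card_ord.
rewrite addn1 IH => H; have km : ((k + m)%:R != 0 :> R).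
  by rewrite pnatr_eq0 -lt0n addn_gt0 m_gt0 orbT.
apply: (mulIf km); rewrite H addnS factS (_ : (m.-1 + k).+1 = k + m)%N; last by lia.
have gen (A x y : R) : x != 0 -> y != 0 -> A / y = A / (x * y) * x.
  by move=> x0 y0; field; rewrite x0 y0.
by rewrite natrM (gen _ (k + m)%:R).
Qed.

Lemma L2sqE (a : Defs.series R m) k :
  L2sq a k = (\sum_(n <- hom_index m k) cabs2 (a n) * mono_norm2 R n)%:E.
Proof.
have ev : hom_eval a k = zpoly (hom_index m k) a.
  apply/funext => z; rewrite /zpoly -(sum_hom_index _ (fun n => a n * zmon n z)).
  apply: eq_bigr => q _; congr (_ * _).
  by apply: eq_bigr => i _; rewrite ffunE.
rewrite /L2sq ev sph_fin ?sph_orthogonal ?hom_index_uniq //.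
exact/nnreg_cabs2/regularC_zpoly.
Qed.

End SphereNorms.

(** * Sums defining the norm of the weighted space *)

Section WeightedNorm.
Local Open Scope ereal_scope.
Local Open Scope classical_set_scope.
Variables (R : realType) (m : nat).
Implicit Types (n : mi m) (a : Defs.series R m) (beta : mi m -> R).

Lemma esum_seq (T : choiceType) (s : seq T) (F : T -> \bar R) : uniq s ->
  (forall t, 0 <= F t) -> \esum_(t in [set` s]) F t = \sum_(t <- s) F t.
Proof.
move=> us F0; rewrite esum_fset; last by move=> t _; exact: F0.
  by rewrite [RHS]fsbig_seq.
exact: finite_seq.
Qed.

Lemma esum_supp (T : choiceType) (s : seq T) (F : T -> \bar R) : uniq s ->
  (forall t, 0 <= F t) -> (forall t, t \notin s -> F t = 0) ->
  \esum_(t in [set: T]) F t = \sum_(t <- s) F t.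
Proof.
move=> us F0 Fs; rewrite (esumID [set` s]) // !setTI esum_seq //.
by rewrite [X in _ + X]esum1 ?adde0 // => n /= /negP; exact: Fs.
Qed.

Lemma sum_le_esum (T : choiceType) (s : seq T) (F : T -> \bar R) : uniq s ->
  (forall t, 0 <= F t) -> \sum_(t <- s) F t <= \esum_(t in [set: T]) F t.
Proof.
move=> us F0; apply: esum_ge; exists [set` s]; last by rewrite fsbig_seq.
by split => //; exact: finite_seq.
Qed.

Lemma esum_mdeg (F : mi m -> \bar R) : (forall n, 0 <= F n) ->
  \esum_(n in [set: mi m]) F n =
  \esum_(k in [set: nat]) \sum_(n <- hom_index m k) F n.
Proof.
move=> F0; rewrite (_ : [set: mi m] = \bigcup_(k in [set: nat]) [set` hom_index m k]).
  rewrite esum_bigcupT //; first by apply: eq_esum => k _; rewrite esum_seq // hom_index_uniq.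
  move=> k l _ _ [n [/=]]; rewrite !mem_hom_index => /eqP <- /eqP <- //.
apply/seteqP; split => // n _; exists (mdeg n) => //=.
by rewrite mem_hom_index.
Qed.

Lemma H2term_ge0 beta a n : 0 <= (cabs2 (a n) * beta n ^+ 2)%:E.
Proof. by rewrite lee_fin mulr_ge0 ?cabs2_ge0 ?sqr_ge0. Qed.

Lemma H2norm2_ge0 beta a : 0 <= H2norm2 beta a.
Proof. by apply: esum_ge0 => n _; exact: H2term_ge0. Qed.

Lemma H2norm2_supp beta a (s : seq (mi m)) : uniq s ->
  (forall n, n \notin s -> a n = 0%R) ->
  H2norm2 beta a = (\sum_(n <- s) cabs2 (a n) * beta n ^+ 2)%:E.
Proof.
move=> us as0; rewrite /H2norm2 (esum_supp us) ?sumEFin // => n; first exact: H2term_ge0.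
by move=> /as0 ->; rewrite cabs20 mul0r.
Qed.

Lemma inH2_supp beta a (s : seq (mi m)) :
  (forall n, n \notin s -> a n = 0%R) -> inH2 beta a.
Proof.
move=> as0; rewrite /inH2 (H2norm2_supp _ (undup_uniq s)) ?ltry // => n.
by rewrite mem_undup; exact: as0.
Qed.

Lemma H2norm2_ge_seq beta a (s : seq (mi m)) : uniq s ->
  (\sum_(n <- s) cabs2 (a n) * beta n ^+ 2)%:E <= H2norm2 beta a.
Proof.
by move=> us; rewrite -sumEFin; apply: sum_le_esum => // n; exact: H2term_ge0.
Qed.

Definition monomial (p : mi m) : Defs.series R m := fun n => (n == p)%:R%R.

Lemma cabs21 : cabs2 (1%R : R[i]) = 1%R.
Proof. by rewrite /cabs2 /= expr1n expr0n addr0. Qed.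

Lemma monomial_supp p n : n \notin [:: p] -> monomial p n = 0%R.
Proof. by rewrite inE /monomial => /negbTE ->. Qed.

Lemma inH2_monomial beta p : inH2 beta (monomial p).
Proof. exact: (inH2_supp beta (@monomial_supp p)). Qed.

Lemma H2norm2_monomial beta p : H2norm2 beta (monomial p) = (beta p ^+ 2)%:E.
Proof.
rewrite (H2norm2_supp _ _ (@monomial_supp p)) // big_seq1 /monomial eqxx.
by rewrite mulr1n cabs21 mul1r.
Qed.

End WeightedNorm.

(** * The norm identity, the weights [beta], and the weighted shift *)

Section NormIdentity.
Local Open Scope classical_set_scope.
Variables (R : realType) (m : nat) (beta : mi m -> R) (b : nat -> R).
Hypothesis m_gt0 : (0 < m)%N.
Hypothesis beta_gt0 : forall n, 0 < beta n.
Hypothesis b_gt0 : forall k, 0 < b k.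

Lemma mono_norm2_gt0 n : 0 < mono_norm2 R (n : mi m).
Proof.
by rewrite mono_norm2E // divr_gt0 ?mulr_gt0 // ltr0n ?fact_gt0 ?mfact_gt0.
Qed.

Lemma norm_identity_of_beta :
  (forall n, beta n ^+ 2 = b (mdeg n) ^+ 2 * mono_norm2 R n) ->
  norm_identity beta b.
Proof.
move=> bE a _; rewrite /H2norm2 esum_mdeg => [|n]; last exact: H2term_ge0.
apply: eq_esum => k _; rewrite L2sqE // -EFinM mulr_sumr -sumEFin.
rewrite big_seq_cond [RHS]big_seq_cond; apply: eq_bigr => n.
rewrite andbT mem_hom_index => /eqP nk.
by rewrite bE nk; congr _%:E; ring.
Qed.

(** Testing the identity on the monomial [z^n] leaves only the term of degree [|n|]. *)
Lemma beta_of_norm_identity : norm_identity beta b ->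
  forall n, beta n ^+ 2 = b (mdeg n) ^+ 2 * mono_norm2 R n.
Proof.
move=> /[swap] n /(_ _ (inH2_monomial beta n)); rewrite H2norm2_monomial => e.
apply: EFin_inj; rewrite e (@esum_supp _ _ [:: mdeg n]) //.
- rewrite big_seq1 L2sqE // -EFinM; congr (_ * _)%:E.
  rewrite (bigD1_seq n) ?mem_hom_index ?hom_index_uniq //= big1 ?addr0.
    by rewrite /monomial eqxx mulr1n cabs21 mul1r.
  by move=> q /negbTE qn; rewrite /monomial qn cabs20 mul0r.
- move=> k; rewrite L2sqE // -EFinM lee_fin mulr_ge0 ?sqr_ge0 // sumr_ge0 // => q _.
  by rewrite mulr_ge0 ?cabs2_ge0 // ltW // mono_norm2_gt0.
- move=> k; rewrite inE L2sqE // => kn; rewrite big_seq_cond big1 ?mule0 // => q.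
  rewrite andbT mem_hom_index /monomial => /eqP qk.
  case: eqP => [qn|_]; last by rewrite cabs20 mul0r.
  by rewrite -qk qn eqxx in kn.
Qed.

Hypothesis betaE : forall n, beta n ^+ 2 = b (mdeg n) ^+ 2 * mono_norm2 R n.

Lemma sqr_inj (x y : R) : 0 <= x -> 0 <= y -> x ^+ 2 = y ^+ 2 -> x = y.
Proof. by move=> x0 y0 e; apply/eqP; rewrite -(@eqrXn2 _ 2) // e. Qed.

Lemma beta_formula n : beta n = b (mdeg n) *
  Num.sqrt ((m.-1)`!%:R * (mfact n)%:R / (m.-1 + mdeg n)`!%:R).
Proof.
rewrite -mono_norm2E //.
have p0 : 0 <= b (mdeg n) * Num.sqrt (mono_norm2 R n).
  by rewrite mulr_ge0 ?sqrtr_ge0 // ltW.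
apply: sqr_inj => //; first exact: ltW.
by rewrite exprMn sqr_sqrtr ?betaE // ltW // mono_norm2_gt0.
Qed.

(** Multiplication by [z_j] has the weights [beta(n + eps_j) / beta(n)] in the orthonormal basis
    [z^n / beta(n)]; these must be the weights of the theorem. *)
Lemma thm_weights_beta (j : 'I_m) n :
  thm_weights b j n * beta n = beta (mshift j 1 n).
Proof.
have w0 : 0 <= thm_weights b j n.
  by rewrite /thm_weights mulr_ge0 ?sqrtr_ge0 // divr_ge0 // ltW.
apply: sqr_inj; [by rewrite mulr_ge0 // ltW|exact: ltW|].
rewrite exprMn !betaE /thm_weights.
rewrite !exprMn exprVn sqr_sqrtr ?divr_ge0 // !mono_norm2E // mdeg_shift mfact_shift1.
rewrite addn1 addnS factS (_ : (m.-1 + mdeg n).+1 = mdeg n + m)%N; last by lia.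
have gen (B' B x N M P f : R) : B != 0 -> N != 0 -> f != 0 ->
    B' ^+ 2 * B ^- 2 * (x / N) * (B ^+ 2 * (M * P / f)) =
    B' ^+ 2 * (M * (x * P) / (N * f)).
  by move=> B0 N0 f0; field; rewrite B0 N0 f0.
by rewrite !natrM gen // ?gt_eqF // ltr0n ?fact_gt0 // addn_gt0 m_gt0 orbT.
Qed.

Lemma unit_equiv_thm_weights : unit_equiv_wshift beta (thm_weights b).
Proof.
(* Coordinates with respect to the orthonormal basis [z^n / beta(n)]. *)
pose V (a : Defs.series R m) : Defs.series R m := fun n => Complex (beta n) 0 * a n.
have VN a : H2norm2 (@one_weight R m) (V a) = H2norm2 beta a.
  apply: eq_esum => n _; rewrite /V cabs2M cabs2_real /one_weight expr1n mulr1.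
  by rewrite mulrC.
have c0 n : Complex (beta n) 0 != 0 :> R[i].
  by rewrite eq_complex /= gt_eqF.
exists V; split; first split.
- by move=> a; rewrite /inH2 VN.
- by move=> c a a' _ _; apply/funext => n; rewrite /V; ring.
- by move=> a _; exact: VN.
- move=> a Ha; have Va : V (fun n => (Complex (beta n) 0)^-1 * a n) = a.
    by apply/funext => n; rewrite /V mulrA mulfV // mul1r.
  by exists (fun n => (Complex (beta n) 0)^-1 * a n) => //; rewrite /inH2 -VN Va.
move=> j a _; apply/funext => n; rewrite /V /Mz /wshift.
case: ifP => nj; last by rewrite mulr0.
rewrite mulrA; congr (_ * _); rewrite -{1}(mshift_pred nj) -thm_weights_beta.
by apply: eqC => /=; ring.
Qed.

End NormIdentity.

(** * The substitution [f(z) |-> f(Uz)] on formal power series *)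

Section LinearSubstitution.
Variables (R : realType) (m : nat).
Implicit Types (n p : mi m) (f g : Defs.series R m) (U V : 'M[R[i]]_m).

(** The formal partial derivative with respect to [z_l]. *)
Definition dser (l : 'I_m) f : Defs.series R m :=
  fun n => (n l).+1%:R * f (mshift l 1 n).

Definition Dser U l f : Defs.series R m := fun n => \sum_j U j l * dser j f n.

(* Euler's identity [(k+1) F = \sum_l z_l d_l F] for the homogeneous part of
   degree [k+1] of [F(z) = f(U z)], where [d_l F = (\sum_j u_jl d_j f)(U z)]. *)
Fixpoint subst_deg U (k : nat) f : Defs.series R m :=
  if k is k'.+1 then
    fun n => k%:R^-1 * \sum_l Mz l (subst_deg U k' (Dser U l f)) n
  else f.

(** A linear substitution preserves degrees, so each coefficient needs only finitely many
    coefficients of [f] and no convergence is involved. *)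
Definition subst U f : Defs.series R m := fun n => subst_deg U (mdeg n) f n.

Lemma natSC_neq0 k : (k.+1%:R != 0 :> R[i]).
Proof. by rewrite pnatr_eq0. Qed.

Lemma sum_delta (F : 'I_m -> R[i]) l : \sum_j (l == j)%:R * F j = F l.
Proof.
rewrite (bigD1 l) //= eqxx mul1r big1 ?addr0 // => j jl.
by rewrite eq_sym (negbTE jl) mul0r.
Qed.

Lemma Mz_shift l f n : Mz l f (mshift l 1 n) = f n.
Proof. by rewrite /Mz mpred_shift mshiftE eqxx addn1. Qed.

(** The Leibniz rule for [z_j f]. *)
Lemma dser_Mz l j f n :
  dser l (Mz j f) n = (l == j)%:R * f n + Mz j (dser l f) n.
Proof.
rewrite /dser; case: (eqVneq l j) => [->|lj].
  rewrite Mz_shift mul1r /Mz; case: (posnP (n j)) => [->|nj].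
    by rewrite mul1r addr0.
  rewrite mshift_pred // ffunE eqxx subn1 prednK //.
  by rewrite -natr1 mulrDl mul1r addrC.
rewrite mul0r add0r /Mz mshiftE eq_sym (negbTE lj) addn0.
case: ifP => nj; last by rewrite mulr0.
rewrite ffunE (negbTE lj) subn0; congr (_ * f _).
by rewrite -{1}(mshift_pred nj) mshiftC mpred_shift.
Qed.

Lemma Mz_ext l f g n : (forall p, n = mshift l 1 p -> f p = g p) ->
  Mz l f n = Mz l g n.
Proof. by move=> fg; rewrite /Mz; case: ifP => // nl; rewrite fg // mshift_pred. Qed.

Lemma dserC l j f n : dser l (dser j f) n = dser j (dser l f) n.
Proof.
rewrite /dser mshiftC !mshiftE (eq_sym j l).
case: (eqVneq l j) => [->//|_]; rewrite !muln0 !addn0; ring.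
Qed.

Lemma Dser_dser U l j f n : dser j (Dser U l f) n = Dser U l (dser j f) n.
Proof.
rewrite /Dser {1}/dser mulr_sumr; apply: eq_bigr => i _.
by rewrite mulrCA -[in RHS]dserC.
Qed.

Lemma DserC U l j f : Dser U l (Dser U j f) = Dser U j (Dser U l f).
Proof.
apply/funext => n; rewrite /Dser.
under eq_bigr => i _ do rewrite Dser_dser /Dser mulr_sumr.
rewrite exchange_big /=; apply: eq_bigr => i _.
rewrite Dser_dser /Dser mulr_sumr; apply: eq_bigr => q _.
by rewrite dserC mulrCA.
Qed.

Lemma dser_lin l (c : R[i]) f g n :
  dser l (fun q => c * f q + g q) n = c * dser l f n + dser l g n.
Proof. by rewrite /dser; ring. Qed.

Lemma Mz_lin l (c : R[i]) f g n :
  Mz l (fun q => c * f q + g q) n = c * Mz l f n + Mz l g n.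
Proof. by rewrite /Mz; case: ifP => // _; rewrite mulr0 addr0. Qed.

Lemma Dser_lin U l (c : R[i]) f g :
  Dser U l (fun q => c * f q + g q) = fun n => c * Dser U l f n + Dser U l g n.
Proof.
apply/funext => n; rewrite /Dser mulr_sumr -big_split /=.
by apply: eq_bigr => j _; rewrite dser_lin; ring.
Qed.

Lemma subst_deg_lin U k (c : R[i]) f g n :
  subst_deg U k (fun q => c * f q + g q) n =
  c * subst_deg U k f n + subst_deg U k g n.
Proof.
elim: k f g n => [//|k IH] f g n.
rewrite [LHS]/= [in RHS]/= [X in _ = X + _]mulrCA -mulrDr; congr (_ * _).
rewrite [X in _ = X + _]mulr_sumr -big_split /=.
apply: eq_bigr => l _; rewrite -Mz_lin Dser_lin; apply: Mz_ext => p _; exact: IH.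
Qed.

Lemma subst_lin U (c : R[i]) f g n :
  subst U (fun q => c * f q + g q) n = c * subst U f n + subst U g n.
Proof. exact: subst_deg_lin. Qed.

Lemma subst0 U n : subst U (fun=> 0) n = 0.
Proof.
have := subst_lin U 1 (fun=> 0) (fun=> 0) n.
have -> : (fun _ : mi m => 1 * 0 + 0) = (fun=> 0) :> Defs.series R m.
  by apply/funext => q; rewrite mulr0 addr0.
by rewrite mul1r => /eqP; rewrite eq_sym -subr_eq0 addrK => /eqP.
Qed.

Lemma subst_sum U (I : Type) (s : seq I) (c : I -> R[i]) (F : I -> Defs.series R m) n :
  subst U (fun q => \sum_(i <- s) c i * F i q) n = \sum_(i <- s) c i * subst U (F i) n.
Proof.
elim: s n => [|i s IH] n.
  rewrite big_nil -[RHS](subst0 U n); congr (subst U _ n).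
  by apply/funext => q; rewrite big_nil.
rewrite big_cons -IH -subst_lin; congr (subst U _ n).
by apply/funext => q; rewrite big_cons.
Qed.

(** The chain rule, obtained by differentiating Euler's formula with the Leibniz rule; the induction
    step needs the operators [Dser U l] to commute. *)
Lemma dser_subst_deg U l k f n : mdeg n = k ->
  dser l (subst_deg U k.+1 f) n = subst_deg U k (Dser U l f) n.
Proof.
elim: k f n => [|k IH] f n nk.
  rewrite (mdeg_eq0 nk) {1}/dser /= !ffunE invr1 !mul1r (bigD1 l) //=.
  rewrite Mz_shift big1 ?addr0 // => j jl.
  by rewrite /Mz mshiftE ffunE (negbTE jl).
have step j : dser l (Mz j (subst_deg U k.+1 (Dser U j f))) n =
    (l == j)%:R * subst_deg U k.+1 (Dser U j f) n +
    Mz j (subst_deg U k (Dser U j (Dser U l f))) n.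
  rewrite dser_Mz; congr (_ + _); apply: Mz_ext => p np.
  rewrite IH ?(DserC U l j) //.
  by move: nk; rewrite np mdeg_shift addn1 => -[].
have -> : dser l (subst_deg U k.+2 f) n = k.+2%:R^-1 *
    \sum_j dser l (Mz j (subst_deg U k.+1 (Dser U j f))) n.
  by rewrite {1}/dser [subst_deg U k.+2 f _]/= mulrCA mulr_sumr.
under eq_bigr => j _ do rewrite step.
rewrite big_split /= (sum_delta (fun j => subst_deg U k.+1 (Dser U j f) n)).
set S := \sum_i _; rewrite -[X in _ + X](mulVKf (natSC_neq0 k)).
(* [T] is the right-hand side by definition; it arises once from differentiating the factor [z_l],
   and [k+1] times from Euler's formula one degree lower. *)
set T := _ * S; change (k.+2%:R^-1 * (T + k.+1%:R * T) = T).
rewrite (_ : k.+2%:R = k.+1%:R + 1); last by rewrite natr1.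
have h : (k.+1%:R + 1 != 0 :> R[i]) by rewrite natr1 natSC_neq0.
by rewrite [T + _](_ : _ = (k.+1%:R + 1) * T) ?mulKf //; ring.
Qed.

Lemma dser_subst U l f n : dser l (subst U f) n = subst U (Dser U l f) n.
Proof.
rewrite /subst -(dser_subst_deg U l f (erefl (mdeg n))) /dser.
by rewrite mdeg_shift addn1.
Qed.

(** In characteristic zero the derivatives determine the coefficients of positive degree, so
    identities between substitutions can be proved by induction on the degree. *)
Lemma dser_eq f g n : (0 < mdeg n)%N ->
  (forall l p, n = mshift l 1 p -> dser l f p = dser l g p) -> f n = g n.
Proof.
move=> n0 fg; have [l nl] : exists l, (0 < n l)%N.
  apply/existsP; apply: contraLR n0; rewrite negb_exists => /forallP n0.
  rewrite -leqNgt leqn0 /mdeg sum_nat_eq0; apply/forallP => l.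
  by have := n0 l; rewrite -eqn0Ngt.
have := fg l (mpred l n) (esym (mshift_pred nl)).
by rewrite /dser mshift_pred // => /(mulfI (natSC_neq0 _)).
Qed.

Lemma subst_deg0 U f n : mdeg n = 0%N -> subst U f n = f n.
Proof. by rewrite /subst => ->. Qed.

(** The composite is [f(VUz)], which explains the order of the product; the proof compares
    derivatives. *)
Lemma substK U V f : V *m U = 1%:M -> subst U (subst V f) = f.
Proof.
move=> VU; apply/funext => n; move: {2}(mdeg n) (erefl (mdeg n)) => k.
elim: k f n => [|k IH] f n nk; first by rewrite !subst_deg0.
apply: dser_eq => [|l p np]; first by rewrite nk.
rewrite dser_subst.
rewrite (_ : Dser U l (subst V f) = subst V (dser l f)).
  by apply: IH; move: nk; rewrite np mdeg_shift addn1 => -[].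
apply/funext => q; rewrite /Dser.
under eq_bigr => j _ do rewrite dser_subst.
rewrite -subst_sum; congr (subst V _ q); apply/funext => t.
rewrite /Dser; under eq_bigr => j _ do rewrite mulr_sumr.
rewrite exchange_big /=.
transitivity (\sum_i (V *m U) i l * dser i f t).
  apply: eq_bigr => i _; rewrite mxE mulr_suml; apply: eq_bigr => j _.
  by rewrite mulrA (mulrC (U j l)).
rewrite VU -[RHS](sum_delta (fun i => dser i f t)).
by apply: eq_bigr => i _; rewrite mxE eq_sym.
Qed.

(** Substitution turns the factor [z_j] into [(Uz)_j]. The Leibniz and chain rules give both sides
    the same derivatives. *)
Lemma subst_Mz U j f n : subst U (Mz j f) n = \sum_k U j k * Mz k (subst U f) n.
Proof.
move: {2}(mdeg n) (erefl (mdeg n)) => d; elim: d f n => [|d IH] f n nd.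
  have n0 := mdeg_eq0 nd.
  rewrite subst_deg0 // n0 /Mz ffunE big1 // => k _.
  by rewrite ffunE mulr0.
apply: (@dser_eq _ (fun n => \sum_k U j k * Mz k (subst U f) n)) => [|l p np].
  by rewrite nd.
rewrite dser_subst.
have -> : Dser U l (Mz j f) = fun q => U j l * f q + Mz j (Dser U l f) q.
  apply/funext => q; rewrite /Dser.
  under eq_bigr => i _ do rewrite dser_Mz mulrDr.
  rewrite big_split /=.
  under eq_bigr => i _ do rewrite mulrCA eq_sym.
  rewrite (sum_delta (fun i => U i l * f q)).
  congr (_ + _); rewrite /Mz; case: ifP => // _.
  by rewrite big1 // => i _; rewrite mulr0.
rewrite subst_lin IH; last by move: nd; rewrite np mdeg_shift addn1 => -[].
rewrite [RHS]/dser mulr_sumr.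
transitivity (\sum_k U j k * dser l (Mz k (subst U f)) p); last first.
  by apply: eq_bigr => k _; rewrite /dser mulrCA.
under [RHS]eq_bigr => k _ do rewrite dser_Mz mulrDr.
rewrite [RHS]big_split /=.
under [X in _ = X + _]eq_bigr => k _ do rewrite mulrCA.
rewrite (sum_delta (fun k => U j k * subst U f p)).
congr (_ + _); apply: eq_bigr => k _; congr (_ * _).
by apply: Mz_ext => q _; rewrite dser_subst.
Qed.

End LinearSubstitution.

(** * Unitary substitutions are isometric; sphericity from [n!]-type weights *)

Section SubstitutionIsometry.
Variables (R : realType) (m : nat).
Implicit Types (n p : mi m) (f g : Defs.series R m) (U V : 'M[R[i]]_m).

(** The squared Fischer (or Fock) norm of the homogeneous part of degree [k]. *)
Definition fock2 (k : nat) f : R :=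
  \sum_(n <- hom_index m k) (mfact n)%:R * cabs2 (f n).

Lemma sum_hom_index_shift (l : 'I_m) k (F : mi m -> R) :
  \sum_(n <- hom_index m k) F (mshift l 1 n) =
  \sum_(q <- hom_index m k.+1 | (0 < q l)%N) F q.
Proof.
rewrite -[RHS]big_filter -(big_map (mshift l 1) xpredT F); apply: perm_big.
apply: uniq_perm; rewrite ?filter_uniq ?hom_index_uniq //.
  rewrite map_inj_uniq ?hom_index_uniq // => n p /(congr1 (mpred l)).
  by rewrite !mpred_shift.
move=> q; rewrite mem_filter mem_hom_index; apply/mapP/andP => [[n + ->]|[ql /eqP qk]].
  rewrite mem_hom_index => /eqP nk.
  by rewrite mdeg_shift nk addn1 mshiftE eqxx addn1.
by exists (mpred l q); rewrite ?mshift_pred // mem_hom_index mdeg_pred // qk.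
Qed.

Lemma cabs2_natM k (a : R[i]) : cabs2 (k%:R * a) = k%:R ^+ 2 * cabs2 a.
Proof. by rewrite cabs2M -(rmorph_nat (real_complex R)) cabs2_real. Qed.

(** Differentiation in [z_l] multiplies the term of index [q] by [q_l], because
    [(n_l + 1)^2 n! = q_l q!] for [q = n + eps_l]; the [q_l] sum to [k+1]. *)
Lemma fock2_dser k f :
  k.+1%:R * fock2 k.+1 f = \sum_l fock2 k (dser l f).
Proof.
have term l : fock2 k (dser l f) = \sum_(q <- hom_index m k.+1)
    (q l)%:R * ((mfact q)%:R * cabs2 (f q)).
  rewrite [RHS](bigID (fun q : mi m => (0 < q l)%N)) /= [X in _ + X]big1 ?addr0.
    rewrite -(sum_hom_index_shift l k
      (fun q => (q l)%:R * ((mfact q)%:R * cabs2 (f q)))).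
    apply: eq_bigr => n _; rewrite /dser cabs2_natM mfact_shift1 mshiftE eqxx addn1.
    by rewrite natrM; ring.
  by move=> q; rewrite -eqn0Ngt => /eqP ->; rewrite mul0r.
under eq_bigr => l _ do rewrite term.
rewrite exchange_big /= mulr_sumr big_seq_cond [RHS]big_seq_cond.
apply: eq_bigr => q; rewrite andbT mem_hom_index => /eqP qk.
by rewrite -mulr_suml -natr_sum -/(mdeg q) qk.
Qed.

Lemma mul_cconj (a : R[i]) : a * cconj a = Complex (cabs2 a) 0.
Proof. by case: a => x y; apply: eqC; rewrite /cabs2 /=; ring. Qed.

Lemma cconjM (a b : R[i]) : cconj (a * b) = cconj a * cconj b.
Proof. by case: a b => ? ? [? ?]; apply: eqC => /=; ring. Qed.

Lemma cconjD (a b : R[i]) : cconj (a + b) = cconj a + cconj b.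
Proof. by case: a b => ? ? [? ?]; apply: eqC => /=; ring. Qed.

Lemma cconj0 : cconj (0 : R[i]) = 0.
Proof. by apply: eqC => /=; rewrite ?oppr0. Qed.

Lemma cconjK : involutive (@cconj R).
Proof. by case=> x y; apply: eqC => //=; rewrite opprK. Qed.

Lemma cconj_sum (I : Type) (s : seq I) (F : I -> R[i]) :
  cconj (\sum_(i <- s) F i) = \sum_(i <- s) cconj (F i).
Proof.
by elim: s => [|i s IH]; rewrite ?big_nil ?cconj0 // !big_cons cconjD IH.
Qed.

Lemma unitary_mx_adj U : unitary_mx U -> unitary_mx (map_mx (@cconj R) U)^T.
Proof.
rewrite /unitary_mx => UU; have -> : map_mx (@cconj R) (map_mx (@cconj R) U)^T = U^T.
  by apply/matrixP => i j; rewrite !mxE cconjK.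
by rewrite trmxK; exact: mulmx1C.
Qed.

(** The chain rule brings in the transpose of [U], whose isometry is the orthonormality of the rows
    of [U]. *)
Lemma unitary_rows U (x : 'I_m -> R[i]) : unitary_mx U ->
  \sum_l cabs2 (\sum_j U j l * x j) = \sum_j cabs2 (x j).
Proof.
move=> UU; apply: (@complexI R).
rewrite !rmorph_sum /=.
transitivity (\sum_l \sum_j \sum_i (U j l * cconj (U i l)) * (x j * cconj (x i))).
  apply: eq_bigr => l _; rewrite [LHS](_ : _ = Complex (cabs2 (\sum_j U j l * x j)) 0) //.
  rewrite -mul_cconj cconj_sum mulr_suml; apply: eq_bigr => j _.
  by rewrite mulr_sumr; apply: eq_bigr => i _; rewrite cconjM; ring.
rewrite exchange_big /=; apply: eq_bigr => j _.
rewrite exchange_big /= -[RHS]/(Complex (cabs2 (x j)) 0) -mul_cconj.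
rewrite -[RHS](sum_delta (fun i => x j * cconj (x i)) j).
apply: eq_bigr => i _; rewrite -mulr_suml; congr (_ * _).
have := congr1 (fun M : 'M[R[i]]_m => M j i) UU; rewrite !mxE => <-.
by apply: eq_bigr => l _; rewrite !mxE.
Qed.

(** By [fock2_dser] it suffices to compare gradients: the induction hypothesis removes the
    substitution from them and [unitary_rows] the matrix. *)
Lemma fock2_subst U k f : unitary_mx U -> fock2 k (subst U f) = fock2 k f.
Proof.
move=> UU; elim: k f => [|k IH] f.
  rewrite /fock2 big_seq_cond [RHS]big_seq_cond; apply: eq_bigr => n.
  by rewrite andbT mem_hom_index => /eqP nk; rewrite subst_deg0.
have k0 : (k.+1%:R != 0 :> R) by rewrite pnatr_eq0.
apply: (mulfI k0); rewrite !fock2_dser.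
transitivity (\sum_l fock2 k (Dser U l f)).
  apply: eq_bigr => l _; rewrite -[RHS]IH; congr (fock2 k _).
  by apply/funext => n; exact: dser_subst.
rewrite /fock2 exchange_big [RHS]exchange_big /=; apply: eq_bigr => n _.
by rewrite -!mulr_sumr; congr (_ * _); exact: unitary_rows.
Qed.

Lemma H2norm2_subst U (beta : mi m -> R) (C : nat -> R) f : unitary_mx U ->
  (forall n, beta n ^+ 2 = C (mdeg n) * (mfact n)%:R) ->
  H2norm2 beta (subst U f) = H2norm2 beta f.
Proof.
move=> UU CE; suff main g : H2norm2 beta g =
    (\esum_(k in [set: nat]%classic) (C k * fock2 k g)%:E)%E.
  by rewrite !main; apply: eq_esum => k _; rewrite fock2_subst.
rewrite /H2norm2 esum_mdeg => [|n]; last exact: H2term_ge0.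
apply: eq_esum => k _; rewrite sumEFin; congr _%:E; rewrite mulr_sumr.
rewrite big_seq_cond [RHS]big_seq_cond; apply: eq_bigr => n.
by rewrite andbT mem_hom_index => /eqP nk; rewrite CE nk; ring.
Qed.

Lemma spherical_of_fact (beta : mi m -> R) (C : nat -> R) :
  (forall n, beta n ^+ 2 = C (mdeg n) * (mfact n)%:R) -> spherical beta.
Proof.
move=> CE U UU; exists (subst U); split; last first.
  by move=> j a _; apply/funext => n; exact: subst_Mz.
have norm W f : unitary_mx W -> H2norm2 beta (subst W f) = H2norm2 beta f.
  by move=> UW; exact: H2norm2_subst CE.
split.
- by move=> a; rewrite /inH2 norm.
- by move=> c a b _ _; apply/funext => n; exact: subst_lin.
- by move=> a _; exact: norm.
- move=> b Hb; exists (subst (map_mx (@cconj R) U)^T b).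
    by rewrite /inH2 norm //; exact: unitary_mx_adj.
  by apply: substK; exact: mulmx1C.
Qed.

End SubstitutionIsometry.

(** * Intertwining unitaries fix the constants up to a phase *)

Section SphericalMonomials.
Variables (R : realType) (m : nat) (beta : mi m -> R).
Hypothesis beta_gt0 : forall n, 0 < beta n.
Implicit Types (n p : mi m) (a : Defs.series R m).

Lemma cabs2_eq0 (x : R[i]) : cabs2 x = 0 -> x = 0.
Proof.
case: x => x y /eqP; rewrite /cabs2 /= paddr_eq0 ?sqr_ge0 // !sqrf_eq0.
by move=> /andP[/eqP -> /eqP ->].
Qed.

Lemma le_H2norm2 a a' : (forall n, cabs2 (a n) <= cabs2 (a' n)) ->
  (H2norm2 beta a <= H2norm2 beta a')%E.
Proof. by move=> le; apply: le_esum => n _; rewrite lee_fin ler_wpM2r ?sqr_ge0. Qed.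

Lemma H2norm2_ge_coef a n : ((cabs2 (a n) * beta n ^+ 2)%:E <= H2norm2 beta a)%E.
Proof.
by have := H2norm2_ge_seq beta a (s := [:: n]) isT; rewrite big_seq1.
Qed.

Lemma Mz_monomial k p : Mz k (monomial R p) = monomial R (mshift k 1 p).
Proof.
apply/funext => n; rewrite /Mz /monomial; case: posnP => [nk|nk].
  case: eqP => // np; move: nk.
  by rewrite np mshiftE eqxx addn1.
rewrite (_ : (mpred k n == p) = (n == mshift k 1 p)) //.
apply/eqP/eqP => [<-|->]; first by rewrite mshift_pred.
by rewrite mpred_shift.
Qed.

Definition erase (s : seq (mi m)) a : Defs.series R m :=
  fun n => if n \in s then 0 else a n.

(** Density of the polynomials: finite partial sums approach the supremum that defines the norm. *)
Lemma H2_tail a (e : R) : inH2 beta a -> 0 < e ->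
  exists2 s : seq (mi m), uniq s &
    (H2norm2 beta (erase s a) < e%:E)%E.
Proof.
move=> Ha e0; pose F n := (cabs2 (a n) * beta n ^+ 2)%:E.
have F0 n : (0 <= F n)%E by exact: H2term_ge0.
have Hfin : H2norm2 beta a \is a fin_num.
  by rewrite ge0_fin_numE ?H2norm2_ge0.
have : (H2norm2 beta a - e%:E < H2norm2 beta a)%E.
  by rewrite lteBlDr // lteDl // lte_fin.
rewrite {2}/H2norm2 => /ereal_sup_gt[_ [X [/finite_seqP[s0 ->] _] <-]].
have us := undup_uniq s0; set s := undup s0 in us.
rewrite (_ : [set` s0]%classic = [set` s]%classic); last first.
  by apply/seteqP; split => n /=; rewrite mem_undup.
rewrite -fsbig_seq // -(esum_seq us F0) => lt; exists s => //.
have split_ : H2norm2 beta a = (\esum_(n in [set` s]%classic) F n +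
    H2norm2 beta (erase s a))%E.
  have := esumID [set` s]%classic [set: mi m]%classic F (fun n _ => F0 n).
  rewrite !setTI => e1; rewrite {1}/H2norm2 -/F e1; congr (_ + _)%E.
  rewrite esum_mkcond; apply: eq_esum => n _; rewrite in_setC.
  rewrite (_ : (n \in [set` s]%classic) = (n \in s)); last by apply/idP/idP; rewrite inE.
  by rewrite /erase /F; case: (n \in s) => //=; rewrite cabs20 mul0r.
have sfin : (\esum_(n in [set` s]%classic) F n)%E \is a fin_num.
  rewrite ge0_fin_numE; last by apply: esum_ge0.
  apply: le_lt_trans Ha; rewrite split_ leeDl //; exact: H2norm2_ge0.
move: lt; rewrite split_ => lt.
rewrite -(lteD2lE _ _ sfin).
by rewrite -lteBlDr.
Qed.

Section Unitary.
Variables (U : 'M[R[i]]_m) (G : Defs.series R m -> Defs.series R m).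
Hypothesis G_unitary : unitary_between beta beta G.
Hypothesis G_Mz : forall (j : 'I_m) a, inH2 beta a ->
  G (Mz j a) = (fun n => \sum_(k < m) U j k * Mz k (G a) n).

Local Notation one := (monomial R (mzero m)).

(** Such a monomial is some [z_l] times another one, so its image is a combination of multiples of
    the coordinates. *)
Lemma unitary_monomial0 n : n != mzero m -> G (monomial R n) (mzero m) = 0.
Proof.
move=> n0; have [l nl] : exists l, (0 < n l)%N.
  apply/existsP; apply: contraNT n0; rewrite negb_exists => /forallP n0.
  by apply/eqP/ffunP => l; have := n0 l; rewrite ffunE -eqn0Ngt => /eqP.
rewrite -(mshift_pred nl) -Mz_monomial G_Mz; last exact: inH2_monomial.
by rewrite big1 // => k _; rewrite /Mz ffunE mulr0.
Qed.

Lemma unitary_finite0 a (s : seq (mi m)) : mzero m \notin s ->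
  G (fun n => \sum_(p <- s) a p * monomial R p n) (mzero m) = 0.
Proof.
case: G_unitary => _ lin _ _.
elim: s => [|p s IH].
  move=> _; set z := (fun n => _).
  have Hz : inH2 beta z.
    by apply: (@inH2_supp _ _ _ _ [::]) => n _; rewrite /z big_nil.
  have := lin (-1) z z Hz Hz; rewrite (_ : (fun n => -1 * z n + z n) = z).
    by move=> -> ; rewrite mulN1r addNr.
  by apply/funext => n; rewrite /z big_nil mulr0 addr0.
rewrite inE negb_or => /andP[p0 s0].
have Hs : inH2 beta (fun n => \sum_(p <- s) a p * monomial R p n).
  apply: (@inH2_supp _ _ _ _ s) => n ns; rewrite big_seq_cond big1 // => q.
  rewrite andbT => qs; rewrite /monomial; case: eqP => [nq|_]; last by rewrite mulr0.
  by rewrite nq qs in ns.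
have := lin (a p) _ _ (inH2_monomial beta p) Hs.
rewrite (_ : (fun n => a p * _ + _) =
  fun n => \sum_(q <- p :: s) a q * monomial R q n).
  by move=> ->; rewrite IH // unitary_monomial0 1?eq_sym // mulr0 addr0.
by apply/funext => n; rewrite big_cons.
Qed.

Lemma unitary_vanish0 a : inH2 beta a -> a (mzero m) = 0 -> G a (mzero m) = 0.
Proof.
case: G_unitary => [GH lin norm _] Ha a0; apply: cabs2_eq0.
apply/eqP; rewrite eq_le cabs2_ge0 andbT leNgt; apply/negP => pos.
(* The contribution of the constant term of [G a] to the norm. A tail of [a] smaller than this
   cannot produce that term, and the finite remainder contributes nothing to it. *)
have e0 : 0 < cabs2 (G a (mzero m)) * beta (mzero m) ^+ 2.
  by rewrite mulr_gt0 // exprn_gt0.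
have [s us small] := H2_tail Ha e0.
set t := erase s a in small.
have Ht : inH2 beta t by rewrite /inH2 (lt_le_trans small) // leey.
pose s' := [seq n <- s | n != mzero m].
pose h n := \sum_(p <- s') a p * monomial R p n.
have hE n : h n = if n \in s then a n else 0.
  case: (boolP (n \in s')) => ns'.
    have : n \in s by move: ns'; rewrite mem_filter => /andP[].
    move=> ->; rewrite /h (bigD1_seq n) ?filter_uniq //= /monomial eqxx mulr1.
    by rewrite big1 ?addr0 // => q /negbTE qn; rewrite eq_sym qn mulr0.
  rewrite /h big_seq_cond big1 => [|q].
    by case: ifP => // ns; move: ns'; rewrite mem_filter ns andbT negbK => /eqP ->.
  rewrite andbT /monomial; case: eqP => [nq|_]; last by rewrite mulr0.
  by move=> qs'; rewrite nq qs' in ns'.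
have Hh : inH2 beta h.
  by apply: (@inH2_supp _ _ _ _ s) => n /negbTE ns; rewrite hE ns.
have hta : (fun n => 1 * h n + t n) = a.
  by apply/funext => n; rewrite mul1r hE /t /erase; case: ifP; rewrite ?addr0 ?add0r.
have := lin 1 _ _ Hh Ht; rewrite hta => Ga.
move: small; rewrite -norm // ltNge => /negP; apply.
rewrite Ga mul1r unitary_finite0 ?add0r; last by rewrite mem_filter eqxx.
exact: H2norm2_ge_coef.
Qed.

(** Let [G h = 1], and let [h0], [c0] be the constant terms of [h] and [G 1]. As series without
    constant term stay such, [h0 c0 = 1]; isometry bounds both moduli by [1], so both equal [1]. The
    constant term of [G 1] then exhausts its norm, and the other coefficients vanish. *)
Lemma unitary_const : exists2 c0 : R[i], cabs2 c0 = 1 &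
  G one = fun n => c0 * one n.
Proof.
case: (G_unitary) => [GH lin norm surj].
have H1 := inH2_monomial beta (mzero m).
have [h Hh Gh] := surj _ H1; set z := mzero m in H1 Gh *.
have b0 : 0 < beta z ^+ 2 by rewrite exprn_gt0.
pose c0 := G one z; pose h0 := h z.
pose h' n := if n == z then 0 else h n.
have Hh' : inH2 beta h'.
  apply: le_lt_trans Hh; apply: le_H2norm2 => n; rewrite /h'.
  by case: ifP; rewrite // cabs20 cabs2_ge0.
have hE : (fun n => h0 * one n + h' n) = h.
  apply/funext => n; rewrite /monomial /h' /h0; case: eqP => [->|_].
    by rewrite mulr1 addr0.
  by rewrite mulr0 add0r.
have hc : h0 * c0 = 1.
  have := lin h0 _ _ H1 Hh'; rewrite hE Gh => /(congr1 (fun f => f z)).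
  rewrite [G h' z]unitary_vanish0 //; last by rewrite /h' eqxx.
  by rewrite addr0 /monomial eqxx => <-.
have le1 a : H2norm2 beta a = (beta z ^+ 2)%:E -> cabs2 (a z) <= 1.
  move=> na; have := H2norm2_ge_coef a z; rewrite na lee_fin.
  by rewrite -[X in _ <= X]mul1r ler_pM2r.
have c1 : cabs2 c0 <= 1 by apply: le1; rewrite norm // H2norm2_monomial.
have h1 : cabs2 h0 <= 1 by apply: le1; rewrite -norm // Gh H2norm2_monomial.
have cc : cabs2 c0 = 1.
  apply/eqP; rewrite eq_le c1 /=; have := congr1 (@cabs2 R) hc.
  by rewrite cabs2M cabs21 => <-; rewrite ler_piMl ?cabs2_ge0.
exists c0 => //; apply/funext => n; rewrite /monomial; case: (eqVneq n z) => [->|nz].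
  by rewrite mulr1.
rewrite mulr0; apply: cabs2_eq0; apply/eqP.
have := @H2norm2_ge_seq _ _ beta (G one) [:: z; n].
rewrite norm // H2norm2_monomial big_cons big_seq1 /= inE eq_sym nz => /(_ isT).
rewrite lee_fin -/c0 cc mul1r gerDl pmulr_lle0 ?exprn_gt0 // => le0.
by rewrite eq_le le0 cabs2_ge0.
Qed.

End Unitary.

End SphericalMonomials.

(** * Sphericity implies the plane relation for [beta] *)

Section SphericalPlaneRelation.
Variables (R : realType) (m : nat) (beta : mi m -> R).
Hypothesis beta_gt0 : forall n, 0 < beta n.
Implicit Types (n p q : mi m) (a : Defs.series R m).

Definition rot_mx (i j : 'I_m) (c s : R) : 'M[R[i]]_m := \matrix_(k, l)
  if k == i then (i == l)%:R * Complex c 0 + (j == l)%:R * Complex s 0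
  else if k == j then (i == l)%:R * - Complex s 0 + (j == l)%:R * Complex c 0
  else (k == l)%:R.

Lemma rot_mx_sum i j c s k (y : 'I_m -> R[i]) :
  \sum_l rot_mx i j c s k l * y l =
  if k == i then Complex c 0 * y i + Complex s 0 * y j
  else if k == j then - Complex s 0 * y i + Complex c 0 * y j else y k.
Proof.
under eq_bigr => l _ do rewrite mxE.
have two A B : \sum_l ((i == l)%:R * A + (j == l)%:R * B) * y l = A * y i + B * y j.
  rewrite -(sum_delta (fun l => A * y l)) -[X in _ = _ + X](sum_delta (fun l => B * y l)).
  by rewrite -big_split; apply: eq_bigr => l _ /=; ring.
case: (k == i); first exact: two.
case: (k == j); first exact: two.
exact: sum_delta.
Qed.

Lemma rot_mx_unitary i j c s : i != j -> c ^+ 2 + s ^+ 2 = 1 ->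
  unitary_mx (rot_mx i j c s).
Proof.
move=> ij cs; have ji : (j == i) = false by rewrite eq_sym (negbTE ij).
have ij' := negbTE ij.
apply/matrixP => k k'; rewrite !mxE.
rewrite (eq_bigr (fun l => rot_mx i j c s k l * cconj (rot_mx i j c s k' l)));
  last by move=> l _; rewrite !mxE.
rewrite rot_mx_sum !mxE !eqxx ij' ji /=.
have cs' : Complex (c ^+ 2 + s ^+ 2) 0 = 1 :> R[i] by rewrite cs.
have [ki|ki] := eqVneq k i; [|have [kj|kj] := eqVneq k j].
- rewrite ki; case: (eqVneq k' i) => [k'i|_].
    by apply: eqC => /=; move: cs; lra.
  by case: (eqVneq k' j) => [k'j|_]; apply: eqC => /=; ring.
- rewrite kj; have [k'i|k'i] := eqVneq k' i.
    by rewrite k'i ji; apply: eqC => /=; ring.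
  have [k'j|k'j] := eqVneq k' j; last by apply: eqC => /=; ring.
  by apply: eqC => /=; move: cs; lra.
have [k'i|k'i] := eqVneq k' i.
  by rewrite k'i (negbTE ki); apply: eqC => /=; ring.
have [k'j|k'j] := eqVneq k' j.
  by rewrite k'j (negbTE kj); apply: eqC => /=; ring.
by rewrite eq_sym; case: (k == k'); apply: eqC => /=; ring.
Qed.

Section Expansion.
Variables (i j : 'I_m) (p : mi m) (c s : R) (c0 : R[i]).
Hypotheses (ij : i != j) (pi : p i = 0%N) (pj : p j = 0%N).

(** As [p] vanishes at [i] and [j], this means that [n] agrees with [p] at all other places. *)
Definition in_plane n := n == mshift i (n i) (mshift j (n j) p).

(* The coefficients of [c0 z^p (c z_i + s z_j)^r]. *)
Definition rot_power (r : nat) : Defs.series R m := fun n =>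
  if in_plane n && (n i + n j == r)%N
  then c0 * ('C(r, n i)%:R * (Complex c 0 ^+ n i * Complex s 0 ^+ n j)) else 0.

Let ji : (j == i) = false. Proof. by rewrite eq_sym (negbTE ij). Qed.

Lemma mshift_inj (k : 'I_m) : injective (mshift k 1).
Proof. by move=> x y /(congr1 (mpred k)); rewrite !mpred_shift. Qed.

Lemma in_plane_shifti q : in_plane (mshift i 1 q) = in_plane q.
Proof.
rewrite /in_plane !mshiftE eqxx ji muln1 muln0 addn0 addn1.
rewrite -[(q i).+1]add1n -(mshift_shift i 1 (q i)).
by rewrite (inj_eq (@mshift_inj i)).
Qed.

Lemma in_plane_shiftj q : in_plane (mshift j 1 q) = in_plane q.
Proof.
rewrite /in_plane !mshiftE eqxx (negbTE ij) muln1 muln0 addn0 addn1.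
rewrite -[(q j).+1]add1n -(mshift_shift j 1 (q j)).
by rewrite mshiftC (inj_eq (@mshift_inj j)).
Qed.

Lemma rot_power_shifti r q : Complex c 0 * rot_power r q =
  if in_plane (mshift i 1 q) && ((q i).+1 + q j == r.+1)%N then
    c0 * ('C(r, q i)%:R * (Complex c 0 ^+ (q i).+1 * Complex s 0 ^+ q j)) else 0.
Proof.
rewrite in_plane_shifti addSn eqSS /rot_power; case: ifP => _; last by rewrite mulr0.
by rewrite exprS; ring.
Qed.

Lemma rot_power_shiftj r q : Complex s 0 * rot_power r q =
  if in_plane (mshift j 1 q) && (q i + (q j).+1 == r.+1)%N then
    c0 * ('C(r, q i)%:R * (Complex c 0 ^+ q i * Complex s 0 ^+ (q j).+1)) else 0.
Proof.
rewrite in_plane_shiftj addnS eqSS /rot_power; case: ifP => _; last by rewrite mulr0.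
by rewrite exprS; ring.
Qed.

(** Multiplication by one more factor [c z_i + s z_j]: Pascal's rule for the coefficients. *)
Lemma rot_powerS r n : Complex c 0 * Mz i (rot_power r) n +
  Complex s 0 * Mz j (rot_power r) n = rot_power r.+1 n.
Proof.
have ei : Complex c 0 * Mz i (rot_power r) n =
    if [&& (0 < n i)%N, in_plane n & (n i + n j == r.+1)%N] then
      c0 * ('C(r, (n i).-1)%:R * (Complex c 0 ^+ n i * Complex s 0 ^+ n j)) else 0.
  rewrite /Mz; case: posnP => ni /=; first by rewrite mulr0.
  rewrite rot_power_shifti mshift_pred // !ffunE eqxx ji subn0 subn1.
  by rewrite prednK.
have ej : Complex s 0 * Mz j (rot_power r) n =
    if [&& (0 < n j)%N, in_plane n & (n i + n j == r.+1)%N] then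
      c0 * ('C(r, n i)%:R * (Complex c 0 ^+ n i * Complex s 0 ^+ n j)) else 0.
  rewrite /Mz; case: posnP => nj /=; first by rewrite mulr0.
  rewrite rot_power_shiftj mshift_pred // !ffunE eqxx (negbTE ij) subn0 subn1.
  by rewrite prednK.
rewrite ei ej /rot_power; case: (in_plane n); last by rewrite !andbF addr0.
case: eqP => [xy|_]; last by rewrite !andbF addr0.
rewrite !andbT /=; set M := _ * (_ ^+ n j).
(* If one exponent is zero, only one of the two terms is present and the binomials are [1]. *)
case: (n i) (n j) xy M => [|x] [|y] //= xy M.
- by rewrite !bin0 add0r.
- have -> : x = r by lia.
  by rewrite !binn addr0.
- by rewrite binS natrD; ring.
Qed.

Lemma rot_power0 : rot_power 0 = fun n => c0 * monomial R p n.
Proof.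
apply/funext => n; rewrite /rot_power /monomial addn_eq0 /in_plane.
case: (eqVneq n p) => [->|np].
  by rewrite pi pj !mshift0 !eqxx /= bin0 !expr0 !mul1r.
rewrite mulr0; case: ifP => // /andP[/eqP + /andP[/eqP ni /eqP nj]].
by rewrite ni nj !mshift0 => e; rewrite e eqxx in np.
Qed.

Lemma rot_power_norm2 r : cabs2 c0 = 1 -> H2norm2 beta (rot_power r) =
  (\sum_(l < r.+1) 'C(r, l)%:R ^+ 2 * (c ^+ 2) ^+ l * (s ^+ 2) ^+ (r - l) *
    beta (mshift i l (mshift j (r - l) p)) ^+ 2)%:E.
Proof.
move=> c1; pose t := [seq mshift i l (mshift j (r - l) p) | l <- index_iota 0 r.+1].
have idx l : mshift i l (mshift j (r - l) p) i = l.
  by rewrite !mshiftE pi eqxx eq_sym ji muln0 muln1.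
have jdx l : mshift i l (mshift j (r - l) p) j = (r - l)%N.
  by rewrite !mshiftE pj eqxx ji muln0 muln1 addn0.
have ut : uniq t.
  rewrite map_inj_uniq ?iota_uniq // => k l /(congr1 (fun q : mi m => q i)).
  by rewrite !idx.
rewrite (H2norm2_supp _ ut) => [|n nt]; last first.
  rewrite /rot_power; case: ifP => // /andP[/eqP nE /eqP xy].
  case/negP: nt; rewrite nE; apply/mapP; exists (n i).
    by rewrite mem_index_iota; lia.
  by rewrite -xy addKn.
rewrite big_map big_mkord; congr _%:E; apply: eq_bigr => l _.
have lr : (l <= r)%N by rewrite -ltnS.
rewrite /rot_power /in_plane idx jdx eqxx subnKC // eqxx /=.
by rewrite !cabs2M c1 mul1r !cabs2X !cabs2_real -[X in cabs2 X]mulr1 cabs2_natM cabs21 mulr1 mulrA.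
Qed.

End Expansion.

Lemma spherical_plane_relation : spherical beta ->
  plane_relation (fun n => beta n ^+ 2).
Proof.
move=> sph_beta i j p r c s ij pi pj _ _ cs.
have ji : (j == i) = false by rewrite eq_sym (negbTE ij).
have [G [G_unitary G_Mz]] := sph_beta _ (rot_mx_unitary ij cs).
have [c0 c1 G1] := unitary_const beta_gt0 G_unitary G_Mz.
have Mz_of k q n : G (Mz k (monomial R q)) n =
    if k == i then Complex c 0 * Mz i (G (monomial R q)) n +
      Complex s 0 * Mz j (G (monomial R q)) n
    else if k == j then - Complex s 0 * Mz i (G (monomial R q)) n +
      Complex c 0 * Mz j (G (monomial R q)) n
    else Mz k (G (monomial R q)) n.
  rewrite G_Mz; last exact: inH2_monomial.
  exact: (rot_mx_sum i j c s k (fun l => Mz l (G (monomial R q)) n)).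
(* The rows of the rotation other than [i] and [j] are trivial, so [G] commutes with the
   corresponding [M_{z_k}] and maps [z^q] as it maps [1]. *)
have Gp q : q i = 0%N -> q j = 0%N ->
    G (monomial R q) = fun n => c0 * monomial R q n.
  move: {2}(mdeg q) (erefl (mdeg q)) => d; elim: d q => [|d IH] q qd qi qj.
    by rewrite (mdeg_eq0 qd).
  have [k qk] : exists k, (0 < q k)%N.
    apply/existsP; have : mdeg q != 0%N by rewrite qd.
    apply: contraNT; rewrite negb_exists => /forallP q0.
    by rewrite /mdeg sum_nat_eq0; apply/forallP => l; have := q0 l; rewrite -eqn0Ngt.
  have ki : (k == i) = false by apply: contraTF qk => /eqP ->; rewrite qi.
  have kj : (k == j) = false by apply: contraTF qk => /eqP ->; rewrite qj.
  apply/funext => n; rewrite -(mshift_pred qk) -Mz_monomial Mz_of ki kj.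
  rewrite IH ?mdeg_pred ?qd //; last 2 first.
  - by rewrite ffunE qi.
  - by rewrite ffunE qj.
  by rewrite /Mz; case: ifP; rewrite ?mulr0.
have Gr k : G (monomial R (mshift i k p)) = rot_power i j p c s c0 k.
  elim: k => [|k IH]; first by rewrite mshift0 Gp // rot_power0.
  apply/funext => n; rewrite -[k.+1]add1n -(mshift_shift i 1 k) -Mz_monomial Mz_of eqxx IH.
  exact: rot_powerS.
apply: EFin_inj; rewrite -H2norm2_monomial -(@rot_power_norm2 i j p c s c0 ij pi pj r c1).
by rewrite -Gr; case: G_unitary => _ _ -> //; exact: inH2_monomial.
Qed.

End SphericalPlaneRelation.

(** * The equivalence and the theorem *)

Lemma spherical_iff_norm_identity (R : realType) (m : nat) (beta : mi m -> R) :
  (0 < m)%N -> (forall n, 0 < beta n) ->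
  spherical beta <->
    exists b : nat -> R, (forall k, 0 < b k) /\ norm_identity beta b.
Proof.
move=> m0 b0; have f0 (q : nat) : 0 < q`!%:R :> R by rewrite ltr0n fact_gt0.
split=> [sph_beta|[b [bpos bnorm]]]; last first.
  apply: (@spherical_of_fact _ _ beta
    (fun k => b k ^+ 2 * ((m.-1)`!%:R / (m.-1 + k)`!%:R))) => n.
  by rewrite (beta_of_norm_identity m0 bnorm) mono_norm2E //; ring.
have [C CE] := plane_relationP (spherical_plane_relation b0 sph_beta) m0.
have C0 k : 0 < C k.
  pose e : mi m := mshift (Ordinal m0) k (mzero m).
  have := CE e; rewrite mdeg_shift mdeg0 add0n => Ce.
  have : 0 < C k * (mfact e)%:R by rewrite -Ce exprn_gt0.
  by rewrite pmulr_lgt0 // ltr0n mfact_gt0.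
have D0 k : 0 < C k * ((m.-1 + k)`!%:R / (m.-1)`!%:R).
  by rewrite mulr_gt0 // divr_gt0.
(* [b k ^+ 2] is the quotient of the constant of [beta] in degree [k] by the constant
   [(m-1)! / (m-1+k)!] of the sphere. *)
exists (fun k => Num.sqrt (C k * ((m.-1 + k)`!%:R / (m.-1)`!%:R))); split=> [k|].
  by rewrite sqrtr_gt0.
apply: norm_identity_of_beta => // n.
rewrite sqr_sqrtr ?ltW // CE mono_norm2E //; field.
by rewrite !gt_eqF.
Qed.

Theorem theorem2p1 (R : realType) (m : nat) (hm : (0 < m)%N)
  (beta : mi m -> R) (hbeta : forall n, 0 < beta n)
  (hbounded : forall j : 'I_m, bounded_op beta (Mz j)) :
  (spherical beta <->
     exists b : nat -> R, (forall k, 0 < b k) /\ norm_identity beta b) /\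
  (forall b : nat -> R, (forall k, 0 < b k) -> norm_identity beta b ->
     unit_equiv_wshift beta (thm_weights b) /\
     forall n : mi m,
       beta n = b (mdeg n) *
         Num.sqrt ((m.-1)`!%:R * (mfact n)%:R / (m.-1 + mdeg n)`!%:R)).
Proof.
split=> [|b bpos bnorm]; first exact: spherical_iff_norm_identity.
have betaE := beta_of_norm_identity hm bnorm.
split=> [|n]; first exact: unit_equiv_thm_weights.
exact: beta_formula.
Qed.
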